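(* Let $R$ be a ring, $M$ an $R$-$R$-bimodule, $R\ltimes M$ the trivial ring extension, $n\geqslant 1$ an integer, and $\mathcal{C},\mathcal{D}$ classes of left $R$-modules. (1) Let $(\mathfrak{U}^{\mathcal{C}},\mathfrak{J}^{\mathcal{D}})$ be a left $n$-cotorsion pair in $R\ltimes M$-$\mathrm{Mod}$. Assume that $\mathrm{Ext}_R^i(M,D)=0$, $\mathrm{Ext}_R^1(\mathrm{Hom}_R(M,D),D)=0$ and $\mathrm{Hom}_R(M,D)\in\mathcal{D}$ for each $1\leqslant i\leqslant n$ and any $D\in\mathcal{D}$, and that $\mathcal{D}_{n-1}^{\wedge}$ is closed under extensions. Then $(\mathcal{C},\mathcal{D})$ is a left $n$-cotorsion pair in $R$-$\mathrm{Mod}$. (2) Let $(\mathfrak{B}^{\mathcal{C}},\mathfrak{U}^{\mathcal{D}})$ be a right $n$-cotorsion pair in $R\ltimes M$-$\mathrm{Mod}$. Assume that $\mathrm{Tor}_i^R(M,C)=0$, $\mathrm{Ext}_R^1(C,M\otimes_R C)=0$ and $M\otimes_R C\in\mathcal{C}$ for each $1\leqslant i\leqslant n$ and any $C\in\mathcal{C}$, and that $\mathcal{C}_{n-1}^{\vee}$ is closed under extensions. Then $(\mathcal{C},\mathcal{D})$ is a right $n$-cotorsion pair in $R$-$\mathrm{Mod}$.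
   Context: Rings are associative with identity, modules are unitary, and $S$-$\mathrm{Mod}$ is the category of left $S$-modules. Classes of modules contain $0$ and are closed under isomorphisms. The trivial ring extension $R\ltimes M$ is $R\times M$ with componentwise addition and $(r_1,m_1)(r_2,m_2)=(r_1r_2,r_1m_2+m_1r_2)$. A left $R\ltimes M$-module is identified with a pair $(X,\alpha)$, where $X$ is a left $R$-module and $\alpha:M\otimes_R X\to X$ is $R$-linear with $\alpha\circ(M\otimes_R\alpha)=0$; equivalently (by adjunction) with a pair $[Y,\beta]$, where $Y$ is a left $R$-module and $\beta:Y\to\mathrm{Hom}_R(M,Y)$ is $R$-linear with $\mathrm{Hom}_R(M,\beta)\circ\beta=0$. Morphisms are $R$-linear maps compatible with the structure maps; a sequence is exact iff the underlying sequence of $R$-modules is exact. For a class $\mathcal{C}$ of left $R$-modules: $\mathfrak{U}^{\mathcal{C}}$ is the class of $R\ltimes M$-modules $(X,\alpha)$ with $X\in\mathcal{C}$ (equivalently $[Y,\beta]$ with $Y\in\mathcal{C}$); $\mathfrak{B}^{\mathcal{C}}$ is the class of $(X,\alpha)$ with $\mathrm{Coker}\,\alpha\in\mathcal{C}$ and $M\otimes_R M\otimes_R X\xrightarrow{M\otimes_R\alpha}M\otimes_R X\xrightarrow{\alpha}X$ exact; $\mathfrak{J}^{\mathcal{C}}$ is the class of $[Y,\beta]$ with $\mathrm{Ker}\,\beta\in\mathcal{C}$ and $Y\xrightarrow{\beta}\mathrm{Hom}_R(M,Y)\xrightarrow{\mathrm{Hom}_R(M,\beta)}\mathrm{Hom}_R(M,\mathrm{Hom}_R(M,Y))$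 exact. For a class $\mathcal{C}$ of objects of an abelian category and $m\geqslant 0$: $\mathcal{C}_m^{\wedge}$ is the class of objects $A$ admitting an exact sequence $0\to C_k\to\cdots\to C_0\to A\to 0$ with all $C_i\in\mathcal{C}$ and some $k\leqslant m$; $\mathcal{C}_m^{\vee}$ is the class of objects $A$ admitting an exact sequence $0\to A\to C^0\to\cdots\to C^k\to 0$ with all $C^i\in\mathcal{C}$ and some $k\leqslant m$. A pair $(\mathcal{C},\mathcal{D})$ of classes of objects in an abelian category is a left $n$-cotorsion pair if (i) $\mathcal{C}$ is closed under direct summands, (ii) $\mathrm{Ext}^i(C,D)=0$ for all $1\leqslant i\leqslant n$, $C\in\mathcal{C}$, $D\in\mathcal{D}$, and (iii) every object $A$ admits a short exact sequence $0\to K\to C\to A\to 0$ with $C\in\mathcal{C}$, $K\in\mathcal{D}_{n-1}^{\wedge}$. It is a right $n$-cotorsion pair if (i') $\mathcal{D}$ is closed under direct summands, (ii) holds, and (iii') every object $A$ admits a short exact sequence $0\to A\to D\to K\to 0$ with $D\in\mathcal{D}$, $K\in\mathcal{C}_{n-1}^{\vee}$. *)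

(* Defs.v *)
From HB Require Import structures.
From mathcomp Require Import all_boot all_order all_algebra.
From mathcomp Require Import boolp.
Set Implicit Arguments.
Unset Strict Implicit.
Unset Printing Implicit Defensive.
Import GRing.Theory.
Local Open Scope ring_scope.
Local Open Scope quotient_scope.

(** * R-R-bimodules *)

HB.mixin Record Lmodule_isBimodule (R : pzRingType) M of GRing.Lmodule R M := {
  rscale : M -> R -> M;
  rscaleDl : forall (m1 m2 : M) r, rscale (m1 + m2) r = rscale m1 r + rscale m2 r;
  rscaleDr : forall (m : M) r1 r2, rscale m (r1 + r2) = rscale m r1 + rscale m r2;
  rscaleA : forall (m : M) r1 r2, rscale m (r1 * r2) = rscale (rscale m r1) r2;
  rscale1 : forall m : M, rscale m 1 = m;
  scaler_rscale : forall r1 (m : M) r2,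
    r1 *: rscale m r2 = rscale (r1 *: m) r2
}.

#[short(type="bimodType")]
HB.structure Definition Bimodule (R : pzRingType) :=
  {M of GRing.Lmodule R M & Lmodule_isBimodule R M}.

Notation "m *< r" := (rscale m r) (at level 40, left associativity) : ring_scope.

Section RscaleTheory.
Context (R : pzRingType) (M : bimodType R).
Implicit Types (m : M) (r : R).

Lemma rscale0l r : (0 : M) *< r = 0.
Proof. by apply: (addIr ((0 : M) *< r)); rewrite -rscaleDl !add0r. Qed.

Lemma rscale0r m : m *< 0 = 0.
Proof. by apply: (addIr (m *< 0)); rewrite -rscaleDr !add0r. Qed.

End RscaleTheory.

(** * The trivial ring extension of R by M *)

Definition trivext (R : pzRingType) (M : bimodType R) : Type := (R * M)%type.

Section Trivext.
Context (R : pzRingType) (M : bimodType R).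
Local Notation S := (trivext M).

HB.instance Definition _ := GRing.Zmodule.copy S (R * M)%type.

Definition trivext_one : S := (1, 0).
Definition trivext_mul (a b : S) : S := (a.1 * b.1, a.1 *: b.2 + a.2 *< b.1).

Lemma trivext_mulA : associative trivext_mul.
Proof.
move=> [a1 a2] [b1 b2] [c1 c2]; congr pair => /=; first by rewrite mulrA.
by rewrite scalerDr scalerA scaler_rscale rscaleDl rscaleA addrA.
Qed.

Lemma trivext_mul1l : left_id trivext_one trivext_mul.
Proof.
by move=> [a1 a2]; congr pair => /=; rewrite ?mul1r // scale1r rscale0l addr0.
Qed.

Lemma trivext_mul1r : right_id trivext_one trivext_mul.
Proof.
by move=> [a1 a2]; congr pair => /=; rewrite ?mulr1 // scaler0 rscale1 add0r.
Qed.

Lemma trivext_mulDl : left_distributive trivext_mul +%R.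
Proof.
move=> [a1 a2] [b1 b2] [c1 c2]; congr pair => /=; first by rewrite mulrDl.
by rewrite scalerDl rscaleDl addrACA.
Qed.

Lemma trivext_mulDr : right_distributive trivext_mul +%R.
Proof.
move=> [a1 a2] [b1 b2] [c1 c2]; congr pair => /=; first by rewrite mulrDr.
by rewrite scalerDr rscaleDr addrACA.
Qed.

HB.instance Definition _ := GRing.Zmodule_isPzRing.Build S
  trivext_mulA trivext_mul1l trivext_mul1r trivext_mulDl trivext_mulDr.

Definition in_base (r : R) : S := (r, 0).
Definition in_ideal (m : M) : S := (0, m).

Lemma in_baseD r1 r2 : in_base (r1 + r2) = in_base r1 + in_base r2.
Proof. by congr pair; rewrite /= addr0. Qed.

Lemma in_base1 : in_base 1 = 1. Proof. by []. Qed.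

Lemma in_baseM r1 r2 : in_base (r1 * r2) = in_base r1 * in_base r2.
Proof. by congr pair; rewrite /= scaler0 rscale0l addr0. Qed.

Lemma in_idealD m1 m2 : in_ideal (m1 + m2) = in_ideal m1 + in_ideal m2.
Proof. by congr pair; rewrite /= addr0. Qed.

Lemma in_idealZ r m : in_ideal (r *: m) = in_base r * in_ideal m.
Proof. by congr pair; rewrite /= ?mulr0 // rscale0l addr0. Qed.

Lemma in_idealR m r : in_ideal (m *< r) = in_ideal m * in_base r.
Proof. by congr pair; rewrite /= ?mul0r // scaler0 add0r. Qed.

End Trivext.

(** * The left R-module M (x)_R X *)

Section Tensor.
Context (R : pzRingType) (M : bimodType R) (X : lmodType R).

(* A sequence of pairs stands for the formal sum of its elementary tensors.
   Formal sums only form a monoid, whence [tens_zero]: it makes (- m, x) an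
   opposite of (m, x) in the quotient. *)
Inductive tens_eq : seq (M * X) -> seq (M * X) -> Prop :=
| tens_refl s : tens_eq s s
| tens_sym s t : tens_eq s t -> tens_eq t s
| tens_trans s t u : tens_eq s t -> tens_eq t u -> tens_eq s u
| tens_cat s s' t t' :
    tens_eq s s' -> tens_eq t t' -> tens_eq (s ++ t) (s' ++ t')
| tens_comm s t : tens_eq (s ++ t) (t ++ s)
| tens_zero x : tens_eq [:: (0, x)] [::]
| tens_addl m1 m2 x : tens_eq [:: (m1 + m2, x)] [:: (m1, x); (m2, x)]
| tens_addr m x1 x2 : tens_eq [:: (m, x1 + x2)] [:: (m, x1); (m, x2)]
| tens_bal m r x : tens_eq [:: (m *< r, x)] [:: (m, r *: x)].

Definition tens_eqb (s t : seq (M * X)) : bool := `[< tens_eq s t >].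

Lemma tens_eqb_refl : reflexive tens_eqb.
Proof. by move=> s; apply/asboolP; apply: tens_refl. Qed.

Lemma tens_eqb_sym : symmetric tens_eqb.
Proof. by move=> s t; apply/asboolP/asboolP => /tens_sym. Qed.

Lemma tens_eqb_trans : transitive tens_eqb.
Proof.
move=> t s u /asboolP st /asboolP tu; apply/asboolP; exact: tens_trans st tu.
Qed.

Canonical tens_equiv := EquivRel tens_eqb tens_eqb_refl tens_eqb_sym tens_eqb_trans.

Definition tensor : Type := {eq_quot tens_equiv}.
HB.instance Definition _ := Choice.on tensor.
HB.instance Definition _ := Quotient.on tensor.

Definition tens_class (s : seq (M * X)) : tensor := \pi_tensor s.
Definition tens (m : M) (x : X) : tensor := tens_class [:: (m, x)].

Lemma tens_classP s t : tens_eq s t <-> tens_class s = tens_class t.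
Proof. by split=> [/asboolP st|/eqmodP/asboolP//]; apply/eqmodP. Qed.

Lemma tens_reprK (t : tensor) : tens_class (repr t) = t.
Proof. exact: reprK. Qed.

Lemma repr_tens s : tens_eq (repr (tens_class s)) s.
Proof. by apply/tens_classP; rewrite tens_reprK. Qed.

Definition tensor_zero : tensor := tens_class [::].
Definition tensor_add (t u : tensor) : tensor := tens_class (repr t ++ repr u).
Definition tensor_map (f : M -> M) (t : tensor) : tensor :=
  tens_class [seq (f p.1, p.2) | p <- repr t].

Lemma tensor_add_class s t :
  tensor_add (tens_class s) (tens_class t) = tens_class (s ++ t).
Proof. by apply/tens_classP; apply: tens_cat; apply: repr_tens. Qed.

Lemma tensor_map_class (f : M -> M) s :
  (forall m1 m2, f (m1 + m2) = f m1 + f m2) ->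
  (forall m r, f (m *< r) = f m *< r) ->
  tensor_map f (tens_class s) = tens_class [seq (f p.1, p.2) | p <- s].
Proof.
move=> fD fR; apply/tens_classP.
have f0 : f 0 = 0 by apply: (addIr (f 0)); rewrite -fD !add0r.
move: (repr (tens_class s)) (repr_tens s) => s0.
elim=> {s s0} /=.
- by move=> ?; apply: tens_refl.
- by move=> *; apply: tens_sym.
- by move=> ? ? ? _ h1 _ h2; apply: tens_trans h1 h2.
- by move=> *; rewrite !map_cat; apply: tens_cat.
- by move=> *; rewrite !map_cat; apply: tens_comm.
- by move=> *; rewrite f0; apply: tens_zero.
- by move=> *; rewrite fD; apply: tens_addl.
- by move=> *; apply: tens_addr.
- by move=> *; rewrite fR; apply: tens_bal.
Qed.

Lemma tensor_class_ind (P : tensor -> Prop) :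
  (forall s, P (tens_class s)) -> forall t, P t.
Proof. by move=> h t; rewrite -(tens_reprK t). Qed.

Lemma tensor_addA : associative tensor_add.
Proof.
elim/tensor_class_ind=> s; elim/tensor_class_ind=> t; elim/tensor_class_ind=> u.
by rewrite !tensor_add_class catA.
Qed.

Lemma tensor_addC : commutative tensor_add.
Proof.
elim/tensor_class_ind=> s; elim/tensor_class_ind=> t.
by rewrite !tensor_add_class; apply/tens_classP/tens_comm.
Qed.

Lemma tensor_add0 : left_id tensor_zero tensor_add.
Proof. by elim/tensor_class_ind=> s; rewrite tensor_add_class. Qed.

Lemma tensor_addN : left_inverse tensor_zero (tensor_map -%R) tensor_add.
Proof.
elim/tensor_class_ind=> s; rewrite tensor_map_class; last first.
- by move=> m r; apply: (addIr (m *< r)); rewrite -rscaleDl !addNr rscale0l.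
- by move=> m1 m2; rewrite opprD.
rewrite tensor_add_class; elim: s => //= -[m x] s ih.
have -> : tens_class ((- m, x) :: [seq (- p.1, p.2) | p <- s] ++ (m, x) :: s) =
    tensor_add (tens_class ([:: (- m, x)] ++ [:: (m, x)]))
      (tens_class ([seq (- p.1, p.2) | p <- s] ++ s)).
  rewrite tensor_add_class; apply/tens_classP; rewrite -catA.
  apply: (tens_cat (tens_refl [:: (- m, x)])).
  rewrite -[(m, x) :: s]/([:: (m, x)] ++ s) !catA.
  by apply: tens_cat; [apply: tens_comm|apply: tens_refl].
rewrite ih tensor_add_class cats0; apply/tens_classP.
apply: tens_trans (tens_zero x); rewrite -(addNr m).
exact/tens_sym/tens_addl.
Qed.

HB.instance Definition _ :=
  GRing.isZmodule.Build tensor tensor_addA tensor_addC tensor_add0 tensor_addN.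

Lemma tens_class_cat s t : tens_class (s ++ t) = tens_class s + tens_class t.
Proof. by rewrite -tensor_add_class. Qed.

Lemma tens_classE s : tens_class s = \sum_(p <- s) tens p.1 p.2.
Proof.
elim: s => [|[m x] s ih]; first by rewrite big_nil.
by rewrite big_cons -ih -tens_class_cat.
Qed.

Definition tensor_scale (r : R) : tensor -> tensor := tensor_map ( *:%R r).

Lemma tensor_scale_class r s :
  tensor_scale r (tens_class s) = tens_class [seq (r *: p.1, p.2) | p <- s].
Proof.
apply: tensor_map_class => [m1 m2|m a]; first exact: scalerDr.
exact: scaler_rscale.
Qed.

Lemma tensor_scaleA r1 r2 t :
  tensor_scale r1 (tensor_scale r2 t) = tensor_scale (r1 * r2) t.
Proof.
elim/tensor_class_ind: t => s; rewrite !tensor_scale_class -map_comp.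
by congr tens_class; apply: eq_map => p /=; rewrite scalerA.
Qed.

Lemma tensor_scale1 : left_id 1 tensor_scale.
Proof.
elim/tensor_class_ind=> s; rewrite tensor_scale_class; congr tens_class.
by rewrite -[RHS]map_id; apply: eq_map => -[m x] /=; rewrite scale1r.
Qed.

Lemma tensor_scaleDr : right_distributive tensor_scale +%R.
Proof.
move=> r; elim/tensor_class_ind=> s; elim/tensor_class_ind=> t.
by rewrite -tens_class_cat !tensor_scale_class map_cat tens_class_cat.
Qed.

Lemma tensor_scaleDl t : {morph tensor_scale^~ t : r1 r2 / r1 + r2}.
Proof.
move=> r1 r2; elim/tensor_class_ind: t => s; rewrite !tensor_scale_class.
rewrite !tens_classE !big_map -big_split /=; apply: eq_bigr => p _.
rewrite -tens_class_cat scalerDl; exact/tens_classP/tens_addl.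
Qed.

HB.instance Definition _ := GRing.Zmodule_isLmodule.Build R tensor
  tensor_scaleA tensor_scale1 tensor_scaleDr tensor_scaleDl.

Lemma tensDl m1 m2 x : tens (m1 + m2) x = tens m1 x + tens m2 x.
Proof. by rewrite -tens_class_cat; apply/tens_classP/tens_addl. Qed.

Lemma tensDr m x1 x2 : tens m (x1 + x2) = tens m x1 + tens m x2.
Proof. by rewrite -tens_class_cat; apply/tens_classP/tens_addr. Qed.

Lemma tens_balanced m r x : tens (m *< r) x = tens m (r *: x).
Proof. exact/tens_classP/tens_bal. Qed.

Lemma tensZ r m x : r *: tens m x = tens (r *: m) x.
Proof. exact: tensor_scale_class. Qed.

Record balanced (A : zmodType) (f : M -> X -> A) : Prop := Balanced {
  balancedDl : forall m1 m2 x, f (m1 + m2) x = f m1 x + f m2 x;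
  balancedDr : forall m x1 x2, f m (x1 + x2) = f m x1 + f m x2;
  balancedM : forall m r x, f (m *< r) x = f m (r *: x)
}.

Definition tlift (A : zmodType) (f : M -> X -> A) (t : tensor) : A :=
  \sum_(p <- repr t) f p.1 p.2.

Section Lift.
Context (A : zmodType) (f : M -> X -> A) (fP : balanced f).

Lemma tlift_class s : tlift f (tens_class s) = \sum_(p <- s) f p.1 p.2.
Proof.
rewrite /tlift; move: (repr (tens_class s)) (repr_tens s) => s0.
elim=> {s s0} //.
- by move=> ? ? ? _ -> _ ->.
- by move=> ? ? ? ? _ h1 _ h2; rewrite !big_cat h1 h2.
- by move=> ? ?; rewrite !big_cat /= addrC.
- move=> x; rewrite big_seq1 big_nil /=; apply: (addIr (f 0 x)).
  by rewrite -(balancedDl fP) !add0r.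
- by move=> *; rewrite !big_cons !big_nil /= !addr0 (balancedDl fP).
- by move=> *; rewrite !big_cons !big_nil /= !addr0 (balancedDr fP).
- by move=> *; rewrite !big_cons !big_nil /= !addr0 (balancedM fP).
Qed.

Lemma tlift_tens m x : tlift f (tens m x) = f m x.
Proof. by rewrite tlift_class big_seq1. Qed.

Lemma tliftD t u : tlift f (t + u) = tlift f t + tlift f u.
Proof.
elim/tensor_class_ind: t => s; elim/tensor_class_ind: u => s'.
by rewrite -tens_class_cat !tlift_class big_cat.
Qed.

End Lift.

Lemma tlift_linear (Y : lmodType R) (f : M -> X -> Y) :
  balanced f -> (forall r m x, f (r *: m) x = r *: f m x) -> linear (tlift f).
Proof.
move=> fP fZ r t u; rewrite tliftD //; congr +%R.
elim/tensor_class_ind: t => s; rewrite [X in tlift f X]tensor_scale_class.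
by rewrite !tlift_class // big_map scaler_sumr; apply: eq_bigr => p _; exact: fZ.
Qed.

End Tensor.

Section TensorMap.
Context (R : pzRingType) (M : bimodType R) (X Y : lmodType R).
Variable g : {linear X -> Y}.

Definition tmap : tensor M X -> tensor M Y := tlift (fun m x => tens m (g x)).

Lemma tmap_balanced : balanced (fun (m : M) x => tens m (g x)).
Proof.
split=> [m1 m2 x|m x1 x2|m r x]; [exact: tensDl | by rewrite linearD tensDr |].
by rewrite tens_balanced linearZ.
Qed.

Lemma tmap_linear : linear tmap.
Proof.
by apply: tlift_linear => [|r m x]; [exact: tmap_balanced | rewrite tensZ].
Qed.

HB.instance Definition _ :=
  GRing.isLinear.Build R (tensor M X) (tensor M Y) *:%R tmap tmap_linear.

End TensorMap.
Arguments tmap {R} M {X Y} g.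

(** * The left R-module Hom_R(M, Y) *)

Definition modHom (R : pzRingType) (M : bimodType R) (Y : lmodType R) : Type :=
  {linear M -> Y}.

Section Hom.
Context (R : pzRingType) (M : bimodType R) (Y : lmodType R).
Local Notation H := (modHom M Y).

Definition hom_fun (f : H) : {linear M -> Y} := f.

Lemma hom_ext (f g : H) : (forall m, hom_fun f m = hom_fun g m) -> f = g.
Proof.
case: f => f cf; case: g => g cg /= fg.
have {}fg : f = g by apply/funext.
case: _ / fg in cg *; congr GRing.Linear.Pack.
case: cf => [[a] [b]]; case: cg => [[a'] [b']].
by rewrite (Prop_irrelevance a a') (Prop_irrelevance b b').
Qed.

HB.instance Definition _ := gen_eqMixin H.
HB.instance Definition _ := gen_choiceMixin H.

Definition mk_hom (f : M -> Y) (lf : linear f) : H :=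
  HB.pack f (GRing.isLinear.Build R M Y *:%R f lf).

Lemma hom_zero_linear : linear (fun _ : M => 0 : Y).
Proof. by move=> a m1 m2; rewrite /= scaler0 addr0. Qed.

Lemma hom_opp_linear (f : H) : linear (fun m => - hom_fun f m).
Proof. by move=> a m1 m2; rewrite linearP opprD scalerN. Qed.

Lemma hom_add_linear (f g : H) : linear (fun m => hom_fun f m + hom_fun g m).
Proof. by move=> a m1 m2; rewrite !linearP scalerDr addrACA. Qed.

Lemma hom_scale_linear (r : R) (f : H) : linear (fun m => hom_fun f (m *< r)).
Proof. by move=> a m1 m2; rewrite rscaleDl -scaler_rscale linearP. Qed.

Definition hom_zero : H := mk_hom hom_zero_linear.
Definition hom_opp (f : H) : H := mk_hom (hom_opp_linear f).
Definition hom_add (f g : H) : H := mk_hom (hom_add_linear f g).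
Definition hom_scale (r : R) (f : H) : H := mk_hom (hom_scale_linear r f).

Lemma hom_addA : associative hom_add.
Proof. by move=> *; apply: hom_ext => m /=; rewrite addrA. Qed.

Lemma hom_addC : commutative hom_add.
Proof. by move=> *; apply: hom_ext => m /=; rewrite addrC. Qed.

Lemma hom_add0 : left_id hom_zero hom_add.
Proof. by move=> *; apply: hom_ext => m /=; rewrite add0r. Qed.

Lemma hom_addN : left_inverse hom_zero hom_opp hom_add.
Proof. by move=> *; apply: hom_ext => m /=; rewrite addNr. Qed.

HB.instance Definition _ :=
  GRing.isZmodule.Build H hom_addA hom_addC hom_add0 hom_addN.

Lemma hom_scaleA r1 r2 f :
  hom_scale r1 (hom_scale r2 f) = hom_scale (r1 * r2) f.
Proof. by apply: hom_ext => m /=; rewrite rscaleA. Qed.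

Lemma hom_scale1 : left_id 1 hom_scale.
Proof. by move=> f; apply: hom_ext => m /=; rewrite rscale1. Qed.

Lemma hom_scaleDr : right_distributive hom_scale +%R.
Proof. by move=> r f g; apply: hom_ext. Qed.

Lemma hom_scaleDl f : {morph hom_scale^~ f : r1 r2 / r1 + r2}.
Proof. by move=> r1 r2; apply: hom_ext => m /=; rewrite rscaleDr linearD. Qed.

HB.instance Definition _ := GRing.Zmodule_isLmodule.Build R H
  hom_scaleA hom_scale1 hom_scaleDr hom_scaleDl.

End Hom.

Section HomMap.
Context (R : pzRingType) (M : bimodType R) (X Y : lmodType R).
Variable g : {linear X -> Y}.

Lemma hom_comp_linear (f : modHom M X) : linear (fun m => g (hom_fun f m)).
Proof. by move=> a m1 m2; rewrite !linearP. Qed.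

Definition hmap (f : modHom M X) : modHom M Y := mk_hom (hom_comp_linear f).

Lemma hmap_linear : linear hmap.
Proof. by move=> r f f'; apply: hom_ext => m /=; rewrite linearD. Qed.

HB.instance Definition _ :=
  GRing.isLinear.Build R (modHom M X) (modHom M Y) *:%R hmap hmap_linear.

End HomMap.
Arguments hmap {R} M {X Y} g.

(** * The pairs (X, alpha) and [Y, beta] of a module over the extension *)

Definition base (R : pzRingType) (M : bimodType R) (Z : lmodType (trivext M)) :
  Type := Z.

Section StructureMaps.
Context (R : pzRingType) (M : bimodType R) (Z : lmodType (trivext M)).
Local Notation X := (base Z).

HB.instance Definition _ := GRing.Zmodule.on X.

Definition base_scale (r : R) (x : X) : X := in_base M r *: (x : Z).

Lemma base_scaleA r1 r2 x :
  base_scale r1 (base_scale r2 x) = base_scale (r1 * r2) x.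
Proof. by rewrite /base_scale scalerA in_baseM. Qed.

Lemma base_scale1 : left_id 1 base_scale.
Proof. by move=> x; rewrite /base_scale in_base1 scale1r. Qed.

Lemma base_scaleDr : right_distributive base_scale +%R.
Proof. by move=> r x y; apply: scalerDr. Qed.

Lemma base_scaleDl x : {morph base_scale^~ x : r1 r2 / r1 + r2}.
Proof. by move=> r1 r2; rewrite /base_scale in_baseD scalerDl. Qed.

HB.instance Definition _ := GRing.Zmodule_isLmodule.Build R X
  base_scaleA base_scale1 base_scaleDr base_scaleDl.

Definition ideal_act (m : M) (x : X) : X := in_ideal m *: (x : Z).

Lemma ideal_actDl m1 m2 x :
  ideal_act (m1 + m2) x = ideal_act m1 x + ideal_act m2 x.
Proof. by rewrite /ideal_act in_idealD scalerDl. Qed.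

Lemma ideal_actDr m x1 x2 :
  ideal_act m (x1 + x2) = ideal_act m x1 + ideal_act m x2.
Proof. exact: (scalerDr (in_ideal m) (x1 : Z) x2). Qed.

Lemma ideal_actR m r x : ideal_act (m *< r) x = ideal_act m (r *: x).
Proof. by rewrite /ideal_act in_idealR -scalerA. Qed.

Lemma ideal_actZ r m x : ideal_act (r *: m) x = r *: ideal_act m x.
Proof. by rewrite /ideal_act in_idealZ -scalerA. Qed.

Definition alpha : tensor M X -> X := tlift ideal_act.

Lemma alpha_linear : linear alpha.
Proof.
apply: tlift_linear; last exact: ideal_actZ.
by split; [exact: ideal_actDl | exact: ideal_actDr | exact: ideal_actR].
Qed.

HB.instance Definition _ :=
  GRing.isLinear.Build R (tensor M X) X *:%R alpha alpha_linear.

Lemma ideal_act_linear (x : X) : linear (ideal_act^~ x).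
Proof. by move=> a m1 m2; rewrite ideal_actDl ideal_actZ. Qed.

Definition beta (x : X) : modHom M X := mk_hom (ideal_act_linear x).

Lemma beta_linear : linear beta.
Proof.
by move=> r x y; apply: hom_ext => m /=; rewrite ideal_actDr ideal_actR.
Qed.

HB.instance Definition _ :=
  GRing.isLinear.Build R X (modHom M X) *:%R beta beta_linear.

End StructureMaps.
Arguments alpha {R M} Z.
Arguments beta {R M} Z.

(** * Homological notions in S-Mod *)

Section Homological.
Context (S : pzRingType).
Implicit Types (A B K L X Y Z : lmodType S) (C D : lmodType S -> Prop).

Definition is_zero A : Prop := forall x : A, x = 0.

Definition surjective (T U : Type) (f : T -> U) : Prop :=
  forall y, exists x, f x = y.

Definition exact (X Y : Type) (Z : lmodType S) (f : X -> Y) (g : Y -> Z) : Prop :=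
  forall y, g y = 0 <-> exists x, f x = y.

Definition iso A B : Prop := exists f : {linear A -> B}, bijective f.

Definition module_class C : Prop :=
  (forall A B, iso A B -> C A -> C B) /\ (forall A, is_zero A -> C A).

Definition short_exact A B L (f : {linear A -> B}) (g : {linear B -> L}) : Prop :=
  [/\ injective f, exact f g & surjective g].

Definition closed_extensions C : Prop :=
  forall A B L (f : {linear A -> B}) (g : {linear B -> L}),
    short_exact f g -> C A -> C L -> C B.

Definition closed_summands C : Prop :=
  forall A X Y, iso A (X * Y)%type -> C A -> C X.

(* Kernels and cokernels are taken up to isomorphism: the classes considered
   are closed under isomorphisms. *)
Definition ker_in C X Y (f : {linear X -> Y}) : Prop :=
  exists K (i : {linear K -> X}), [/\ injective i, exact i f & C K].

Definition coker_in C X Y (f : {linear X -> Y}) : Prop :=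
  exists L (p : {linear Y -> L}), [/\ exact f p, surjective p & C L].

(* ... -> X_1 -> X_0 -> A -> 0 *)
Record resolution A := Resolution {
  res_obj :> nat -> lmodType S;
  res_d : forall i, {linear res_obj i.+1 -> res_obj i};
  res_aug : {linear res_obj 0 -> A};
  res_exact : forall i, exact (res_d i.+1) (res_d i);
  res_exact0 : exact (res_d 0) res_aug;
  res_surj : surjective res_aug
}.

(* 0 -> A -> X^0 -> X^1 -> ... *)
Record coresolution A := Coresolution {
  cores_obj :> nat -> lmodType S;
  cores_d : forall i, {linear cores_obj i -> cores_obj i.+1};
  cores_aug : {linear A -> cores_obj 0};
  cores_inj : injective cores_aug;
  cores_exact0 : exact cores_aug (cores_d 0);
  cores_exact : forall i, exact (cores_d i) (cores_d i.+1)
}.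

(* A finite exact sequence 0 -> C_k -> ... -> C_0 -> A -> 0 is encoded as a
   resolution which is zero in degrees > k; dually for [cores_le]. *)
Definition res_le C (m : nat) A : Prop :=
  exists (k : nat) (P : resolution A), [/\ (k <= m)%N,
    forall i, (i <= k)%N -> C (P i) & forall i, (k < i)%N -> is_zero (P i)].

Definition cores_le C (m : nat) A : Prop :=
  exists (k : nat) (Q : coresolution A), [/\ (k <= m)%N,
    forall i, (i <= k)%N -> C (Q i) & forall i, (k < i)%N -> is_zero (Q i)].

Definition projective A : Prop :=
  forall X Y (g : {linear X -> Y}) (f : {linear A -> Y}),
    surjective g -> exists h : {linear A -> X}, forall a, g (h a) = f a.

(* Ext^i_S(A, B) = 0: the i-th cohomology of Hom_S(P, B) vanishes, for P a
   projective resolution of A (its choice is immaterial). *)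
Definition Ext_zero (i : nat) A B : Prop :=
  exists P : resolution A, (forall j, projective (P j)) /\
  match i with
  | 0 => forall f : {linear P 0%N -> B},
      (forall x, f (res_d P 0 x) = 0) -> forall x, f x = 0
  | j.+1 => forall f : {linear P j.+1 -> B},
      (forall x, f (res_d P j.+1 x) = 0) ->
      exists g : {linear P j -> B}, forall x, g (res_d P j x) = f x
  end.

Definition left_cotorsion_pair (n : nat) C D : Prop :=
  [/\ closed_summands C,
      forall i X Y, (1 <= i <= n)%N -> C X -> D Y -> Ext_zero i X Y
    & forall A, exists K X (f : {linear K -> X}) (g : {linear X -> A}),
        [/\ short_exact f g, C X & res_le D n.-1 K]].

Definition right_cotorsion_pair (n : nat) C D : Prop :=
  [/\ closed_summands D,
      forall i X Y, (1 <= i <= n)%N -> C X -> D Y -> Ext_zero i X Y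
    & forall A, exists Y K (f : {linear A -> Y}) (g : {linear Y -> K}),
        [/\ short_exact f g, D Y & cores_le C n.-1 K]].

End Homological.

(* Tor_i^R(M, A) = 0: the i-th homology of M (x)_R P vanishes, for P a
   projective resolution of A. *)
Definition Tor_zero (R : pzRingType) (i : nat) (M : bimodType R)
    (A : lmodType R) : Prop :=
  exists P : resolution A, (forall j, projective (P j)) /\
  match i with
  | 0 => surjective (tmap M (res_d P 0))
  | j.+1 => exact (tmap M (res_d P j.+1)) (tmap M (res_d P j))
  end.

(** * The classes U^C, B^C and J^C *)

Section Classes.
Context (R : pzRingType) (M : bimodType R) (C : lmodType R -> Prop).
Implicit Types Z : lmodType (trivext M).

Definition classU Z : Prop := C (base Z).

Definition classB Z : Prop :=
  coker_in C (alpha Z) /\ exact (tmap M (alpha Z)) (alpha Z).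

Definition classJ Z : Prop :=
  ker_in C (beta Z) /\ exact (beta Z) (hmap M (beta Z)).

End Classes.
Arguments classU {R} M C Z.
Arguments classB {R} M C Z.
Arguments classJ {R} M C Z.

(* Main.v *)
From HB Require Import structures.
Require Import Defs.
From mathcomp Require Import all_boot all_order all_algebra.
From mathcomp Require Import boolp functions.
Set Implicit Arguments.
Unset Strict Implicit.
Unset Printing Implicit Defensive.
Import GRing.Theory.
Local Open Scope ring_scope.
Local Open Scope quotient_scope.

(** Write S for the trivial extension of R by M, and (X, 0) for an R-module X on
    which M acts by zero. Closure under summands passes from S to R along
    X |-> (X, 0); the two other axioms need an argument.

    Orthogonality is a change of rings along R -> S. On the left, Y |->
    Hom_R(S, Y) is right adjoint to restriction and maps D into the class J.
    Restriction is exact and sends a free S-module to a direct sum of copies of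
    R + M, on which Ext(-, Y) vanishes; hence Ext over S against Hom_R(S, Y)
    computes Ext over R against Y in the relevant degrees [ext_coinduced]. On the
    right, X |-> S (x) X is left adjoint to restriction, maps C into the class B,
    preserves projective modules, and is exact where Tor vanishes [ext_induced].

    For approximations, one approximates (A, 0) over S and restricts to R; what
    remains is to resolve the kernel K by D, given a resolution of K by the class
    J. The terms of that resolution are only extensions of Hom(M, Y) by Y with Y
    in D, so restricting it is not enough. Instead, by induction on the length
    [classJ_resolution]: the functor Ker beta turns the resolution of K into a
    resolution of Ker beta_K by D; Ext^j(M, Ker beta_K) vanishes in a range of
    degrees that shrinks by one at each step, so that Hom(M, -) keeps this
    resolution exact; and the image of beta_K is the whole of Hom(M, Ker beta_K).
    Thus K is an extension of Hom(M, Ker beta_K) by Ker beta_K, both of which have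
    D-resolutions of the right length, and closure under extensions applies. The
    right-hand case is dual, with Coker alpha, M (x) - and Tor
    [classB_coresolution].

    Ext and Tor share one dimension-shifting argument: vanishing in degree 1 is a
    condition on all short exact sequences ending in the module, and higher
    degrees are reached through syzygies [van_shift], [van_unshift]. *)

(** * Submodules, quotients, pullbacks and direct sums *)

Section LinearMaps.
Context (S : pzRingType).
Implicit Types (A B K X Y Z : lmodType S).

Definition mk_lin X Y (f : X -> Y) (lf : linear f) : {linear X -> Y} :=
  HB.pack f (GRing.isLinear.Build S X Y *:%R f lf).

Lemma exact_comp0 X Y Z (f : {linear X -> Y}) (g : {linear Y -> Z}) :
  exact f g -> forall x, g (f x) = 0.
Proof. by move=> fg x; apply/fg; exists x. Qed.

Lemma linear_inj0 X Y (f : {linear X -> Y}) :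
  (forall x, f x = 0 -> x = 0) -> injective f.
Proof. by move=> h x y fxy; apply/subr0_eq/h; rewrite linearB fxy subrr. Qed.

Lemma ker_lift K X Y Z (i : {linear K -> X}) (f : {linear X -> Y})
    (h : {linear Z -> X}) :
  injective i -> exact i f -> (forall z, f (h z) = 0) ->
  exists k : {linear Z -> K}, forall z, i (k z) = h z.
Proof.
move=> inj ex fh0.
have /choice[k kE] : forall z, exists k, i k = h z by move=> z; apply/ex/fh0.
have kl : linear k by move=> a z z'; apply: inj; rewrite linearP !kE linearP.
by exists (mk_lin kl).
Qed.

Lemma coker_lift X Y Z (g : {linear X -> Y}) (h : {linear X -> Z}) :
  surjective g -> (forall x, g x = 0 -> h x = 0) ->
  exists k : {linear Y -> Z}, forall x, k (g x) = h x.
Proof.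
move=> surj gh; have /choice[s sE] := surj.
have hs x : h (s (g x)) = h x.
  by apply/subr0_eq; rewrite -linearB; apply: gh; rewrite linearB sE subrr.
have kl : linear (fun y => h (s y)).
  by move=> a y y'; rewrite -linearP -[RHS]hs (linearP g) !sE.
by exists (mk_lin kl).
Qed.

End LinearMaps.

Section Submodule.
Context (S : pzRingType) (X : lmodType S).

Record submod (U : X -> Prop) : Prop := Submod {
  submod0 : U 0;
  submodD : forall x y, U x -> U y -> U (x + y);
  submodZ : forall a x, U x -> U (a *: x)
}.

Context (U : X -> Prop) (hU : submod U).

Definition sub of submod U : Type := {x : X | U x}.
Local Notation W := (sub hU).

HB.instance Definition _ := gen_eqMixin W.
HB.instance Definition _ := gen_choiceMixin W.

Definition sub_val (w : W) : X := sval w.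

Lemma sub_val_inj : injective sub_val.
Proof. by move=> [x hx] [y hy] /= xy; apply: eq_exist. Qed.

Definition sub_mk x (hx : U x) : W := exist _ x hx.
Definition sub_zero : W := sub_mk (submod0 hU).
Definition sub_add (v w : W) : W := sub_mk (submodD hU (svalP v) (svalP w)).
Definition sub_scale a (v : W) : W := sub_mk (submodZ hU a (svalP v)).
Definition sub_opp (v : W) : W := sub_scale (-1) v.

Lemma sub_addA : associative sub_add.
Proof. by move=> *; apply: sub_val_inj => /=; rewrite addrA. Qed.
Lemma sub_addC : commutative sub_add.
Proof. by move=> *; apply: sub_val_inj => /=; rewrite addrC. Qed.
Lemma sub_add0 : left_id sub_zero sub_add.
Proof. by move=> *; apply: sub_val_inj => /=; rewrite add0r. Qed.
Lemma sub_addN : left_inverse sub_zero sub_opp sub_add.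
Proof. by move=> *; apply: sub_val_inj => /=; rewrite scaleN1r addNr. Qed.

HB.instance Definition _ :=
  GRing.isZmodule.Build W sub_addA sub_addC sub_add0 sub_addN.

Lemma sub_scaleA a b v : sub_scale a (sub_scale b v) = sub_scale (a * b) v.
Proof. by apply: sub_val_inj => /=; rewrite scalerA. Qed.
Lemma sub_scale1 : left_id 1 sub_scale.
Proof. by move=> *; apply: sub_val_inj => /=; rewrite scale1r. Qed.
Lemma sub_scaleDr : right_distributive sub_scale +%R.
Proof. by move=> *; apply: sub_val_inj => /=; rewrite scalerDr. Qed.
Lemma sub_scaleDl v : {morph sub_scale^~ v : a b / a + b}.
Proof. by move=> *; apply: sub_val_inj => /=; rewrite scalerDl. Qed.

HB.instance Definition _ := GRing.Zmodule_isLmodule.Build S W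
  sub_scaleA sub_scale1 sub_scaleDr sub_scaleDl.

Lemma sub_val_linear : linear sub_val.
Proof. by []. Qed.

HB.instance Definition _ :=
  GRing.isLinear.Build S W X *:%R sub_val sub_val_linear.

Definition incl : {linear W -> X} := sub_val.

Lemma incl_inj : injective incl. Proof. exact: sub_val_inj. Qed.
Lemma inclP w : U (incl w). Proof. exact: svalP. Qed.
(** ** The quotient by a submodule *)

Definition quo_eqb (x y : X) : bool := `[< U (x - y) >].

Lemma quo_eqb_refl : reflexive quo_eqb.
Proof. by move=> x; apply/asboolP; rewrite subrr; apply: (submod0 hU). Qed.

Lemma submodN x : U x -> U (- x).
Proof. by move=> ux; rewrite -scaleN1r; apply: (submodZ hU). Qed.

Lemma quo_eqb_sym : symmetric quo_eqb.
Proof.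
by move=> x y; apply/asboolP/asboolP => /submodN; rewrite opprB.
Qed.

Lemma quo_eqb_trans : transitive quo_eqb.
Proof.
move=> y x z /asboolP xy /asboolP yz; apply/asboolP.
by have := submodD hU xy yz; rewrite addrA subrK.
Qed.

Canonical quo_equiv := EquivRel quo_eqb quo_eqb_refl quo_eqb_sym quo_eqb_trans.

Definition quo : Type := {eq_quot quo_equiv}.
Local Notation Q := quo.
HB.instance Definition _ := Choice.on Q.
HB.instance Definition _ := Quotient.on Q.

Definition quo_class (x : X) : Q := \pi_Q x.

Lemma quo_classP x y : U (x - y) <-> quo_class x = quo_class y.
Proof. by split=> [h|/eqmodP/asboolP//]; apply/eqmodP/asboolP. Qed.

Lemma quo_class_surj : surjective quo_class.
Proof. by move=> q; exists (repr q); apply: reprK. Qed.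

Lemma repr_quo x : U (repr (quo_class x) - x).
Proof. by apply/quo_classP; apply: reprK. Qed.

Definition quo_add (p q : Q) : Q := quo_class (repr p + repr q).
Definition quo_scale a (p : Q) : Q := quo_class (a *: repr p).
Definition quo_opp (p : Q) : Q := quo_scale (-1) p.

Lemma quo_add_class x y : quo_add (quo_class x) (quo_class y) = quo_class (x + y).
Proof.
by apply/quo_classP; rewrite opprD addrACA; apply: (submodD hU); apply: repr_quo.
Qed.

Lemma quo_scale_class a x : quo_scale a (quo_class x) = quo_class (a *: x).
Proof. by apply/quo_classP; rewrite -scalerBr; apply/(submodZ hU)/repr_quo. Qed.

Lemma quo_ind (P : Q -> Prop) : (forall x, P (quo_class x)) -> forall q, P q.
Proof. by move=> h q; have [x <-] := quo_class_surj q. Qed.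

Lemma quo_addA : associative quo_add.
Proof.
elim/quo_ind=> x; elim/quo_ind=> y; elim/quo_ind=> z.
by rewrite !quo_add_class addrA.
Qed.
Lemma quo_addC : commutative quo_add.
Proof. by elim/quo_ind=> x; elim/quo_ind=> y; rewrite !quo_add_class addrC. Qed.
Lemma quo_add0 : left_id (quo_class 0) quo_add.
Proof. by elim/quo_ind=> x; rewrite quo_add_class add0r. Qed.
Lemma quo_addN : left_inverse (quo_class 0) quo_opp quo_add.
Proof.
by elim/quo_ind=> x; rewrite /quo_opp quo_scale_class quo_add_class scaleN1r addNr.
Qed.

HB.instance Definition _ :=
  GRing.isZmodule.Build Q quo_addA quo_addC quo_add0 quo_addN.

Lemma quo_classD x y : quo_class (x + y) = quo_class x + quo_class y.
Proof. by rewrite -quo_add_class. Qed.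

Lemma quo_scaleA a b q : quo_scale a (quo_scale b q) = quo_scale (a * b) q.
Proof. by elim/quo_ind: q => x; rewrite !quo_scale_class scalerA. Qed.
Lemma quo_scale1 : left_id 1 quo_scale.
Proof. by elim/quo_ind=> x; rewrite quo_scale_class scale1r. Qed.
Lemma quo_scaleDr : right_distributive quo_scale +%R.
Proof.
move=> a; elim/quo_ind=> x; elim/quo_ind=> y.
by rewrite -quo_classD !quo_scale_class scalerDr quo_classD.
Qed.
Lemma quo_scaleDl q : {morph quo_scale^~ q : a b / a + b}.
Proof.
move=> a b; elim/quo_ind: q => x.
by rewrite !quo_scale_class scalerDl quo_classD.
Qed.

HB.instance Definition _ := GRing.Zmodule_isLmodule.Build S Q
  quo_scaleA quo_scale1 quo_scaleDr quo_scaleDl.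

Lemma quo_class_linear : linear quo_class.
Proof. by move=> a x y; rewrite quo_classD -quo_scale_class. Qed.

HB.instance Definition _ :=
  GRing.isLinear.Build S X Q *:%R quo_class quo_class_linear.

Definition proj : {linear X -> Q} := quo_class.

Lemma proj_surj : surjective proj. Proof. exact: quo_class_surj. Qed.
Lemma proj0P x : proj x = 0 <-> U x.
Proof. by have := quo_classP x 0; rewrite subr0; case. Qed.

End Submodule.
Arguments incl {S X U} hU.
Arguments proj {S X U} hU.

Section ShortExact.
Context (S : pzRingType).
Implicit Types (A B K X Y Z : lmodType S).

Lemma ker_submod X Y (g : {linear X -> Y}) : submod (fun x => g x = 0).
Proof.
split=> [|x y gx gy|a x gx]; first exact: linear0.
  by rewrite linearD gx gy addr0.
by rewrite linearZ_LR gx scaler0.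
Qed.

Definition ker X Y (g : {linear X -> Y}) : lmodType S := sub (ker_submod g).
Definition ker_incl X Y (g : {linear X -> Y}) : {linear ker g -> X} :=
  incl (ker_submod g).

Lemma ker_incl_inj X Y (g : {linear X -> Y}) : injective (ker_incl g).
Proof. exact: incl_inj. Qed.

Lemma ker_incl_exact X Y (g : {linear X -> Y}) : exact (ker_incl g) g.
Proof.
move=> x; split=> [gx|[y <-]]; last exact: (inclP y).
by exists (sub_mk (ker_submod g) gx).
Qed.

Lemma ker_ses X Y (g : {linear X -> Y}) :
  surjective g -> short_exact (ker_incl g) g.
Proof. by split=> //; [apply: ker_incl_inj | apply: ker_incl_exact]. Qed.

Lemma img_submod X Y (g : {linear X -> Y}) : submod (fun y => exists x, g x = y).
Proof.
split=> [|_ _ [x <-] [y <-]|a _ [x <-]]; first by exists 0; apply: linear0.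
  by exists (x + y); rewrite linearD.
by exists (a *: x); rewrite linearZ_LR.
Qed.

Definition coker X Y (g : {linear X -> Y}) : lmodType S := quo (img_submod g).
Definition coker_proj X Y (g : {linear X -> Y}) : {linear Y -> coker g} :=
  proj (img_submod g).

Lemma coker_proj_surj X Y (g : {linear X -> Y}) : surjective (coker_proj g).
Proof. exact: proj_surj. Qed.

Lemma coker_proj_exact X Y (g : {linear X -> Y}) : exact g (coker_proj g).
Proof. by move=> y; apply: proj0P. Qed.

Lemma iso_of_bij A B (f : {linear A -> B}) :
  injective f -> surjective f -> iso A B.
Proof.
move=> inj /choice[s sE]; exists f; exists s => // x.
by apply: inj; rewrite sE.
Qed.

Lemma iso_sym A B : iso A B -> iso B A.
Proof.
move=> [f [g fK gK]].
have gl : linear g by move=> a x y; rewrite -{1}[x]gK -{1}[y]gK -linearP fK.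
by exists (mk_lin gl); exists f.
Qed.

Lemma copair_linear X Y Z (f : {linear X -> Z}) (g : {linear Y -> Z}) :
  linear (fun p : (X * Y)%type => f p.1 + g p.2).
Proof. by move=> a p q; rewrite /= !linearP scalerDr addrACA. Qed.
Definition copair X Y Z (f : {linear X -> Z}) (g : {linear Y -> Z}) :
  {linear (X * Y)%type -> Z} := mk_lin (copair_linear f g).

Lemma pair_linear X Y Z (f : {linear X -> Y}) (g : {linear X -> Z}) :
  linear (fun x => (f x, g x) : (Y * Z)%type).
Proof. by move=> a x y; congr pair; rewrite linearP. Qed.
Definition pair_lin X Y Z (f : {linear X -> Y}) (g : {linear X -> Z}) :
  {linear X -> (Y * Z)%type} := mk_lin (pair_linear f g).

Lemma inl_linear X Y : linear (fun x : X => (x, 0) : (X * Y)%type).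
Proof. by move=> a x x'; congr pair; rewrite /= scaler0 addr0. Qed.
Definition inl_lin X Y : {linear X -> (X * Y)%type} := mk_lin (@inl_linear X Y).

Lemma inr_linear X Y : linear (fun y : Y => (0, y) : (X * Y)%type).
Proof. by move=> a y y'; congr pair; rewrite /= scaler0 addr0. Qed.
Definition inr_lin X Y : {linear Y -> (X * Y)%type} := mk_lin (@inr_linear X Y).

Lemma fst_linear X Y : linear (fun p : (X * Y)%type => p.1).
Proof. by []. Qed.
Definition fst_lin X Y : {linear (X * Y)%type -> X} := mk_lin (@fst_linear X Y).

Lemma snd_linear X Y : linear (fun p : (X * Y)%type => p.2).
Proof. by []. Qed.
Definition snd_lin X Y : {linear (X * Y)%type -> Y} := mk_lin (@snd_linear X Y).

Lemma zero_linear X Y : linear (fun _ : X => 0 : Y).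
Proof. by move=> a x y; rewrite /= scaler0 addr0. Qed.
Definition zero_lin X Y : {linear X -> Y} := mk_lin (@zero_linear X Y).

Lemma residue_linear X (f : {linear X -> X}) : linear (fun x => x - f x).
Proof. by move=> a x y; rewrite /= linearP opprD addrACA -scalerBr. Qed.
Definition residue X (f : {linear X -> X}) : {linear X -> X} :=
  mk_lin (residue_linear f).

(** ** Pullbacks *)

Section Pullback.
Context (X Y A : lmodType S) (g : {linear X -> A}) (p : {linear Y -> A}).

Lemma pb_submod : submod (fun e : X * Y => g e.1 = p e.2).
Proof.
split=> [|e e' ge ge'|a e ge] /=; first by rewrite !linear0.
  by rewrite !linearD ge ge'.
by rewrite !linearZ_LR ge.
Qed.

Definition pb : lmodType S := sub pb_submod.

Definition pb1 : {linear pb -> X} := (fst_lin X Y \o incl pb_submod)%FUN.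
Definition pb2 : {linear pb -> Y} := (snd_lin X Y \o incl pb_submod)%FUN.

Lemma pbE (e : pb) : g (pb1 e) = p (pb2 e).
Proof. exact: (inclP e). Qed.

Lemma pb_ext (e e' : pb) : pb1 e = pb1 e' -> pb2 e = pb2 e' -> e = e'.
Proof.
move=> h1 h2; apply: (@incl_inj _ _ _ pb_submod).
by rewrite [LHS]surjective_pairing [RHS]surjective_pairing; congr pair.
Qed.

Lemma pb_ex x y : g x = p y -> exists e : pb, pb1 e = x /\ pb2 e = y.
Proof. by move=> h; exists (sub_mk pb_submod (h : g (x, y).1 = p (x, y).2)). Qed.

Lemma pb_pair Z (u : {linear Z -> X}) (v : {linear Z -> Y}) :
  (forall z, g (u z) = p (v z)) ->
  exists w : {linear Z -> pb}, forall z, pb1 (w z) = u z /\ pb2 (w z) = v z.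
Proof.
move=> h; have /choice[w wE] z := pb_ex (h z).
have wl : linear w.
  move=> a z z'; have [h1 h2] := wE (a *: z + z').
  have [[h3 h4] [h5 h6]] := (wE z, wE z').
  by apply: pb_ext; rewrite !linearP ?h1 ?h2 ?h3 ?h4 ?h5 ?h6 linearP.
by exists (mk_lin wl).
Qed.

End Pullback.

Lemma pb_ses1 K X Y A (i : {linear K -> X}) (g : {linear X -> A})
    (p : {linear Y -> A}) : short_exact i g ->
  exists j : {linear K -> pb g p},
    [/\ short_exact j (pb2 g p), forall k, pb1 g p (j k) = i k
      & forall k, pb2 g p (j k) = 0].
Proof.
move=> [inj ex surj].
have [k|j jE] := @pb_pair _ _ _ g p K i (zero_lin K Y).
  by rewrite /= linear0; apply: exact_comp0 ex k.
exists j; split=> [|k|k]; try by have [] := jE k.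
split=> [k k' jk|e|y].
- by apply: inj; have [<- _] := jE k; have [<- _] := jE k'; rewrite jk.
- split=> [e2|[k <-]]; last by have [] := jE k.
  have /ex[k ke] : g (pb1 g p e) = 0 by rewrite pbE e2 linear0.
  by exists k; have [h1 h2] := jE k; apply: pb_ext; rewrite ?h1 ?h2 ?e2.
- by have [x gx] := surj (p y); have [e [_ e2]] := pb_ex gx; exists e.
Qed.

Lemma pb_ses2 K X Y A (i : {linear K -> Y}) (g : {linear X -> A})
    (p : {linear Y -> A}) : short_exact i p ->
  exists j : {linear K -> pb g p},
    [/\ short_exact j (pb1 g p), forall k, pb2 g p (j k) = i k
      & forall k, pb1 g p (j k) = 0].
Proof.
move=> [inj ex surj].
have [k|j jE] := @pb_pair _ _ _ g p K (zero_lin K X) i.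
  by rewrite /= linear0; apply/esym/(exact_comp0 ex).
exists j; split=> [|k|k]; try by have [] := jE k.
split=> [k k' jk|e|x].
- by apply: inj; have [_ <-] := jE k; have [_ <-] := jE k'; rewrite jk.
- split=> [e1|[k <-]]; last by have [] := jE k.
  have /ex[k ke] : p (pb2 g p e) = 0 by rewrite -pbE e1 linear0.
  by exists k; have [h1 h2] := jE k; apply: pb_ext; rewrite ?h1 ?h2 ?e1.
- by have [y py] := surj (g x); have [e [e1 _]] := pb_ex (esym py); exists e.
Qed.

End ShortExact.
Arguments ker_incl {S X Y} g.
Arguments coker_proj {S X Y} g.
Arguments pb1 {S X Y A} g p.
Arguments pb2 {S X Y A} g p.

(** * Direct sums of copies of a module *)

Section DirectSum.
Context (S : pzRingType) (I : Type) (X : lmodType S).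
Local Notation T := {classic I}.

Definition fin_supp (f : T -> X) : Prop :=
  exists s : seq T, forall i, f i <> 0 -> i \in s.

Lemma fin_supp_submod : @submod S (T -> X)%type fin_supp.
Proof.
split=> [|f g [s hs] [t ht]|a f [s hs]]; first by exists [::].
  exists (s ++ t) => i fg; rewrite mem_cat.
  have [fi|/hs -> //] := EM (f i = 0); apply/orP; right; apply: ht => gi.
  by apply: fg; rewrite -[(f + g) i]/(f i + g i) fi gi addr0.
exists s => i afi; apply: hs => fi; apply: afi.
by rewrite -[(a *: f) i]/(a *: f i) fi scaler0.
Qed.

(** Functions of finite support: exactness of [dsum] can be checked pointwise. *)
Definition dsum : lmodType S := sub fin_supp_submod.

Definition coeff (f : dsum) (i : T) : X := incl fin_supp_submod f i.

Lemma coeff_ext f g : coeff f = coeff g -> f = g.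
Proof. exact: incl_inj. Qed.

Lemma coeffP a f g i : coeff (a *: f + g) i = a *: coeff f i + coeff g i.
Proof. by []. Qed.

Lemma coeff_linear i : linear (coeff^~ i).
Proof. by []. Qed.

Lemma coeff_supp f : exists s : seq T, uniq s /\ forall i, coeff f i <> 0 -> i \in s.
Proof.
have [s hs] := inclP f; exists (undup s); split; first exact: undup_uniq.
by move=> i /hs; rewrite mem_undup.
Qed.

Definition single_fun (i : T) (x : X) (j : T) : X := if j == i then x else 0.

Lemma single_supp i x : fin_supp (single_fun i x).
Proof. by exists [:: (i : T)] => j; rewrite inE /single_fun; case: eqP. Qed.

Lemma single_linear i : linear (fun x => sub_mk fin_supp_submod (single_supp i x)).
Proof.
move=> a x y; apply: coeff_ext; apply/funext => j.
rewrite coeffP /coeff /= /single_fun; case: ifP => // _.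
by rewrite scaler0 addr0.
Qed.

Definition single (i : T) : {linear X -> dsum} := mk_lin (single_linear i).

Lemma coeff_single i x j : coeff (single i x) j = if j == i then x else 0.
Proof. by []. Qed.

Section UniversalProperty.
Context (Y : lmodType S) (h : I -> {linear X -> Y}).

Definition dsum_graph (f : dsum) (y : Y) : Prop :=
  exists s : seq T, [/\ uniq s, forall i, coeff f i <> 0 -> i \in s
    & y = \sum_(i <- s) h i (coeff f i)].

(** Both sums reduce to the sum over the exact support. *)
Lemma dsum_supp_sum (f : dsum) (s t : seq T) : uniq s -> uniq t ->
  (forall i, coeff f i <> 0 -> i \in s) -> (forall i, coeff f i <> 0 -> i \in t) ->
  \sum_(i <- s) h i (coeff f i) = \sum_(i <- t) h i (coeff f i).
Proof.
move=> us ut hs ht.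
have red (r : seq T) : \sum_(i <- r) h i (coeff f i) =
    \sum_(i <- [seq i <- r | coeff f i != 0]) h i (coeff f i).
  rewrite big_filter [RHS]big_mkcond; apply: eq_bigr => i _.
  by case: eqP => // ->; rewrite linear0.
rewrite red [RHS]red; apply: perm_big; apply: uniq_perm; try exact: filter_uniq.
by move=> i; rewrite !mem_filter; case: eqP => // /[dup] /hs -> /ht ->.
Qed.

Lemma dsum_lift : exists H : {linear dsum -> Y}, forall i x, H (single i x) = h i x.
Proof.
have /choice[H HE] f : exists y, dsum_graph f y.
  by have [s [us hs]] := coeff_supp f; exists (\sum_(i <- s) h i (coeff f i)); exists s.
have HS f (s : seq T) : uniq s -> (forall i, coeff f i <> 0 -> i \in s) ->
    H f = \sum_(i <- s) h i (coeff f i).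
  by move=> us hs; have [t [ut ht ->]] := HE f; apply: dsum_supp_sum.
have Hl : linear H.
  move=> a f g.
  have [[s [us hs]] [t [ut ht]]] := (coeff_supp f, coeff_supp g).
  have hsub j : coeff f j <> 0 \/ coeff g j <> 0 -> j \in undup (s ++ t).
    by rewrite mem_undup mem_cat => -[/hs -> //|/ht ->]; rewrite orbT.
  have ust := undup_uniq (s ++ t).
  rewrite !(HS _ (undup (s ++ t))) //; first last.
  - move=> i fgi; apply: hsub; apply/not_andP => -[f0 g0]; apply: fgi.
    by rewrite coeffP f0 g0 scaler0 addr0.
  - by move=> i fi; apply: hsub; left.
  - by move=> i gi; apply: hsub; right.
  rewrite scaler_sumr -big_split; apply: eq_bigr => i _ /=.
  by rewrite coeffP linearP.
exists (mk_lin Hl) => i x /=; rewrite (HS _ [:: (i : T)]) //.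
  by rewrite big_seq1 coeff_single eqxx.
by move=> j; rewrite coeff_single inE; case: eqP.
Qed.

End UniversalProperty.

Lemma dsum_hom_eq (Y : lmodType S) (u v : {linear dsum -> Y}) :
  (forall i x, u (single i x) = v (single i x)) -> forall f, u f = v f.
Proof.
move=> uv f; have [s [us hs]] := coeff_supp f.
have -> : f = \sum_(i <- s) single i (coeff f i).
  apply: coeff_ext; apply/funext => j.
  have cs r : coeff (\sum_(i <- r) single i (coeff f i)) j =
      \sum_(i <- r) coeff (single i (coeff f i)) j.
    exact: (linear_sum (mk_lin (coeff_linear j))).
  rewrite cs; have [js|/negP js] := boolP ((j : T) \in s).
    rewrite (bigD1_seq (j : T)) //= coeff_single eqxx big1 ?addr0 // => i ij.
    by rewrite coeff_single eq_sym (negbTE ij).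
  rewrite big1_seq => [|i /andP[_ is_]].
    by apply: contrapT => /hs.
  by rewrite coeff_single; case: eqP => // ji; case: js; rewrite ji.
by rewrite !linear_sum; apply: eq_bigr => i _.
Qed.

End DirectSum.
Arguments single {S I X} i.

Section DirectSumMap.
Context (S : pzRingType) (I : Type).
Implicit Types (X Y A K : lmodType S).

Lemma dsum_map_supp X Y (g : {linear X -> Y}) (f : dsum I X) :
  fin_supp (fun i => g (coeff f i)).
Proof.
have [s [_ hs]] := coeff_supp f; exists s => i gi.
by apply: hs => fi; apply: gi; rewrite fi linear0.
Qed.

Lemma dsum_map_linear X Y (g : {linear X -> Y}) :
  linear (fun f : dsum I X => sub_mk (fin_supp_submod I Y) (dsum_map_supp g f)).
Proof.
by move=> a f f'; apply: coeff_ext; apply/funext => i; rewrite [LHS]linearP.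
Qed.

Definition dsum_map X Y (g : {linear X -> Y}) : {linear dsum I X -> dsum I Y} :=
  mk_lin (dsum_map_linear g).

Lemma coeff_map X Y (g : {linear X -> Y}) f i :
  coeff (dsum_map g f) i = g (coeff f i).
Proof. by []. Qed.

Lemma dsum_map_single X Y (g : {linear X -> Y}) i x :
  dsum_map g (single i x) = single i (g x).
Proof.
apply: coeff_ext; apply/funext => j; rewrite coeff_map !coeff_single.
by case: ifP => // _; rewrite linear0.
Qed.

(** Pointwise choice keeps the support finite because it can return 0 over 0. *)
Lemma dsum_choice X Y (r : X -> Y -> Prop) (f : dsum I Y) :
  r 0 0 -> (forall i, exists x, r x (coeff f i)) ->
  exists f' : dsum I X, forall i, r (coeff f' i) (coeff f i).
Proof.
move=> r0 /choice[h hE]; have [s [_ hs]] := coeff_supp f.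
pose f' i := if `[< coeff f i = 0 >] then 0 else h i.
have f's : fin_supp (f' : {classic I} -> X).
  by exists s => i; rewrite /f'; case: asboolP => // /hs.
exists (sub_mk (fin_supp_submod I X) f's) => i; rewrite /coeff /= /f'.
by case: asboolP => [|_]; [rewrite /coeff => -> | apply: hE].
Qed.

Lemma dsum_ses K X A (i : {linear K -> X}) (g : {linear X -> A}) :
  short_exact i g -> short_exact (dsum_map i) (dsum_map g).
Proof.
move=> [inj ex surj]; split=> [f f' ff'|f|f].
- apply: coeff_ext; apply/funext => j; apply: inj.
  by rewrite -!coeff_map ff'.
- split=> [gf|[f' <-]]; last first.
    by apply: coeff_ext; apply/funext => j; rewrite !coeff_map (exact_comp0 ex).
  have [||f' hf'] := @dsum_choice _ _ (fun k x => i k = x) f.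
  + exact: linear0.
  + by move=> j; apply/ex; rewrite -coeff_map gf.
  by exists f'; apply: coeff_ext; apply/funext.
- have [||f' hf'] := @dsum_choice _ _ (fun x a => g x = a) f.
  + exact: linear0.
  + by move=> j; apply: surj.
  by exists f'; apply: coeff_ext; apply/funext.
Qed.

End DirectSumMap.
Arguments dsum_map {S} I {X Y} g.

(** * Projective modules *)

Section Projective.
Context (S : pzRingType).
Implicit Types (A K P Q X Y : lmodType S).

Lemma projective_dsum I P : projective P -> projective (dsum I P).
Proof.
move=> pP X Y g f gs.
have /choice[h hE] i : exists h : {linear P -> X}, forall x, g (h x) = f (single i x).
  exact: (pP _ _ g (f \o single i)%FUN gs).
have [H HE] := dsum_lift h; exists H => x.
by apply: (dsum_hom_eq (u := (g \o H)%FUN)) => i y /=; rewrite HE hE.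
Qed.

Lemma projective_ring : projective (S^o : lmodType S).
Proof.
move=> X Y g f gs; have [x gx] := gs (f 1).
have hl : linear (fun a : S^o => (a : S) *: x).
  by move=> a b c; rewrite scalerDl -scalerA.
by exists (mk_lin hl) => a /=; rewrite linearZ_LR gx -linearZ_LR /= [_ *: _]mulr1.
Qed.

Lemma projective_prod P Q : projective P -> projective Q -> projective (P * Q)%type.
Proof.
move=> pP pQ X Y g f gs.
have [h1 h1E] := pP _ _ g (f \o inl_lin P Q)%FUN gs.
have [h2 h2E] := pQ _ _ g (f \o inr_lin P Q)%FUN gs.
exists (copair h1 h2) => x; rewrite /= linearD h1E h2E /= -linearD; congr (f _).
by case: x => p q; congr pair; rewrite /= ?addr0 ?add0r.
Qed.

Lemma projective_zero A : is_zero A -> projective A.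
Proof.
by move=> a0 X Y g f _; exists (zero_lin A X) => a; rewrite (a0 a) !linear0.
Qed.

(** The direct sum of copies of S indexed by the elements of A maps onto A. *)
Definition free_on A : lmodType S := dsum A (S^o : lmodType S).

Lemma projective_free A : projective (free_on A).
Proof. exact/projective_dsum/projective_ring. Qed.

Lemma free_onto_ex A : exists f : {linear free_on A -> A}, surjective f.
Proof.
have hl (a : A) : linear (fun s : S^o => (s : S) *: a).
  by move=> r s t; rewrite scalerDl -scalerA.
have [f fE] := dsum_lift (fun a : A => mk_lin (hl a)).
by exists f => a; exists (single a (1 : S^o)); rewrite fE /= scale1r.
Qed.

Lemma projective_cover A : exists K P (i : {linear K -> P}) (g : {linear P -> A}),
  projective P /\ short_exact i g.
Proof.
have [f fs] := free_onto_ex A.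
exists (ker f), (free_on A), (ker_incl f), f; split; last exact: ker_ses.
exact: projective_free.
Qed.

End Projective.

(** * Dimension shifting *)

Section SesLemmas.
Context (S : pzRingType).
Implicit Types (A B E K L P X Y Z : lmodType S).

Lemma ses_retraction K X A (i : {linear K -> X}) (g : {linear X -> A})
    (s : {linear A -> X}) : short_exact i g -> (forall a, g (s a) = a) ->
  exists r : {linear X -> K}, forall k, r (i k) = k.
Proof.
move=> [inj ex _] gs.
have [x|r rE] := ker_lift (h := residue (s \o g)%FUN) inj ex.
  by rewrite /= linearB gs subrr.
by exists r => k; apply: inj; rewrite rE /= (exact_comp0 ex) linear0 subr0.
Qed.

Lemma id_ses A : exists K (i : {linear K -> A}),
  is_zero K /\ short_exact i (idfun : {linear A -> A}).
Proof.
exists (ker (idfun : {linear A -> A})), (ker_incl idfun); split.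
  by move=> x; apply: ker_incl_inj; rewrite linear0; apply: (inclP x).
by apply: ker_ses => x; exists x.
Qed.

(** The third isomorphism theorem for the kernel of a composite: it is an
    extension of Ker g by Ker q. *)
Lemma ses_comp_ker K X A L E (i : {linear K -> X}) (g : {linear X -> A})
    (j : {linear L -> E}) (q : {linear E -> X}) :
  short_exact i g -> short_exact j q ->
  exists (j' : {linear L -> ker (g \o q)%FUN}) (q' : {linear ker (g \o q)%FUN -> K}),
    [/\ short_exact j' q', short_exact (ker_incl (g \o q)%FUN) (g \o q)%FUN,
        forall l, ker_incl (g \o q)%FUN (j' l) = j l
      & forall n, i (q' n) = q (ker_incl (g \o q)%FUN n)].
Proof.
move=> [i_inj i_ex g_surj] [j_inj j_ex q_surj].
have [||l|j' j'E] := @ker_lift _ _ _ _ _ (ker_incl (g \o q)%FUN) (g \o q)%FUN j.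
- exact: ker_incl_inj.
- exact: ker_incl_exact.
- by rewrite /= (exact_comp0 j_ex) linear0.
have [//|//|n|q' q'E] := @ker_lift _ _ _ _ _ i g (q \o ker_incl (g \o q))%FUN.
  by have /(_ (ker_incl _ n)) := ker_incl_exact (g \o q)%FUN; case=> _; apply; exists n.
exists j', q'; split=> //; last first.
  apply: ker_ses => a; have [x <-] := g_surj a; have [e <-] := q_surj x.
  by exists e.
split.
- by move=> l l' ll; apply: j_inj; rewrite -!j'E ll.
- move=> n; split=> [n0|[l <-]].
    have /j_ex[l jl] : q (ker_incl _ n) = 0 by rewrite -[LHS]q'E n0 linear0.
    by exists l; apply: ker_incl_inj; rewrite j'E.
  by apply: i_inj; rewrite q'E /= j'E (exact_comp0 j_ex) linear0.
- move=> k; have [e qe] := q_surj (i k).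
  have /(ker_incl_exact (g \o q)%FUN)[n ne] : (g \o q)%FUN e = 0.
    by rewrite /= qe (exact_comp0 i_ex).
  by exists n; apply: i_inj; rewrite q'E /= ne.
Qed.

End SesLemmas.

(** A half exact functor enters the argument only through the monomorphisms on
    which it stays exact: V i will say that Hom(-, B) sends i to a surjection, or
    that M (x) - sends i to an injection. *)
Section Derived.
Context (S : pzRingType) (V : forall K X : lmodType S, {linear K -> X} -> Prop).
Implicit Types (A B C E K L P X Y : lmodType S).

Hypothesis V_split : forall K X (i : {linear K -> X}) (r : {linear X -> K}),
  (forall k, r (i k) = k) -> V i.
Hypothesis V_comp : forall K X Y (i : {linear K -> X}) (j : {linear X -> Y})
  (k : {linear K -> Y}), (forall x, k x = j (i x)) -> V i -> V j -> V k.
Hypothesis V_cancel : forall K X Y (i : {linear K -> X}) (j : {linear X -> Y})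
  (k : {linear K -> Y}), (forall x, k x = j (i x)) -> V k -> V i.
Hypothesis V_pushout : forall K P K' X A (i : {linear K -> P}) (g : {linear P -> A})
  (i' : {linear K' -> X}) (g' : {linear X -> A})
  (u : {linear P -> X}) (v : {linear K -> K'}),
  short_exact i g -> short_exact i' g' ->
  (forall p, g' (u p) = g p) -> (forall k, u (i k) = i' (v k)) -> V i -> V i'.

(** The first derived functor vanishes on A. Quantifying over all sequences
    ending in A, and not only over one projective cover, makes extensions and
    retracts of such A easy. *)
Definition van1 A : Prop :=
  forall K X (i : {linear K -> X}) (g : {linear X -> A}), short_exact i g -> V i.

(** The derived functor of degree n + 1 vanishes on A. *)
Fixpoint van (n : nat) A : Prop :=
  if n is m.+1 then exists K P (i : {linear K -> P}) (g : {linear P -> A}),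
    [/\ short_exact i g, projective P & van m K]
  else van1 A.

(** Any sequence ending in A is a pushout of a projective cover of A. *)
Lemma van1_of_cover K P A (i : {linear K -> P}) (g : {linear P -> A}) :
  short_exact i g -> projective P -> V i -> van1 A.
Proof.
move=> ses pP Vi K' X i' g' ses'.
have [inj' ex' surj'] := ses'; have [_ ex _] := ses.
have [u uE] := pP _ _ g' g surj'.
have [k|v vE] := ker_lift (h := (u \o i)%FUN) inj' ex'.
  by rewrite /= uE (exact_comp0 ex).
exact: (V_pushout (u := u) (v := v) ses ses').
Qed.

Lemma van_projective n P : projective P -> van n P.
Proof.
elim: n P => [|n IHn] P pP.
  move=> K X i g ses; have [_ _ surj] := ses.
  have [s sE] := pP _ _ g idfun surj.
  by have [r rE] := ses_retraction ses sE; apply: (V_split (r := r)).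
have [K [i [K0 ses]]] := id_ses P.
by exists K, P, i, idfun; split=> //; apply/IHn/projective_zero.
Qed.

(** In the pullback of a projective P -> A along X -> A, the sequence over P
    splits, so K is a retract of the pullback, while the other sequence presents
    the pullback as an extension of X by the syzygy of A. The closure properties
    of [van n] are hypotheses because they are proved by the same induction. *)
Lemma van_shift_from n K X A (i : {linear K -> X}) (g : {linear X -> A}) :
  (forall B Y (s : {linear B -> Y}) (p : {linear Y -> B}),
     (forall b, p (s b) = b) -> van n Y -> van n B) ->
  (forall B Y C (j : {linear B -> Y}) (q : {linear Y -> C}),
     short_exact j q -> van n B -> van n C -> van n Y) ->
  short_exact i g -> van n.+1 A -> van n X -> van n K.
Proof.
move=> retr ext ses [K0 [P [i0 [g0 [ses0 pP vK0]]]]] vX.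
have [j [ses_j _ _]] := pb_ses1 g0 ses; have [_ _ j_surj] := ses_j.
have [j0 [ses_j0 _ _]] := pb_ses2 g ses0.
have [s sE] := pP _ _ (pb2 g g0) idfun j_surj.
have [r rE] := ses_retraction ses_j sE.
by apply: (retr _ _ j r rE); apply: ext ses_j0 vK0 vX.
Qed.

(** In positive degrees, retracts are handled by a cover of X of the form F + G,
    where F covers the retract A, so that the syzygy of A is a retract of that of
    X; extensions are handled by the horseshoe lemma. *)
Lemma van_retract_middle n :
  (forall A X (s : {linear A -> X}) (p : {linear X -> A}),
     (forall a, p (s a) = a) -> van n X -> van n A) /\
  (forall K X A (i : {linear K -> X}) (g : {linear X -> A}),
     short_exact i g -> van n K -> van n A -> van n X).
Proof.
elim: n => [|n [retr ext]]; split.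
- move=> A X s p ps vX K E i g ses.
  have [j [ses_j jE j0]] := pb_ses1 p ses.
  have [e|w wE] := pb_pair (g := g) (p := p) (u := idfun) (v := (s \o g)%FUN).
    by rewrite /= ps.
  apply: (V_cancel (j := w) (k := j)) => [k|]; last exact: vX ses_j.
  have [w1 w2] := wE (i k); apply: pb_ext; rewrite ?w1 ?w2 ?jE ?j0 //=.
  by have [_ /exact_comp0 -> _] := ses; rewrite linear0.
- move=> K X A i g ses vK vA L E j q ses_j.
  have [j' [q' [ses' ses_n jE _]]] := ses_comp_ker ses ses_j.
  exact: V_comp (fun l => esym (jE l)) (vK _ _ _ _ ses') (vA _ _ _ _ ses_n).
- move=> A X s p ps vX.
  have [L [F [j [a [pF ses_a]]]]] := projective_cover A.
  have [L' [G [j' [b [pG ses_b]]]]] := projective_cover X.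
  pose c : {linear (F * G)%type -> X} :=
    copair (s \o a)%FUN (residue (s \o p) \o b)%FUN.
  have c_surj : surjective c.
    move=> x; have [[_ _ sa] [_ _ sb]] := (ses_a, ses_b).
    have [[f fE] [h hE]] := (sa (p x), sb x).
    by exists (f, h); rewrite /= fE hE addrC subrK.
  exists L, F, j, a; split=> //.
  have vN : van n (ker c).
    apply: (van_shift_from retr ext (ker_ses c_surj) vX).
    exact/van_projective/projective_prod.
  have [||l|u uE] := @ker_lift _ _ _ _ _ (ker_incl c) c (inl_lin F G \o j)%FUN.
  + exact: ker_incl_inj.
  + exact: ker_incl_exact.
  + have [_ /exact_comp0 aj0 _] := ses_a.
    by rewrite /= aj0 !(linear0, subr0, addr0).
  have [j_inj a_ex _] := ses_a.
  have [//|//|y|v vE] := @ker_lift _ _ _ _ _ j a (fst_lin F G \o ker_incl c)%FUN.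
    have /(ker_incl_exact c) : exists z, ker_incl c z = ker_incl _ y.
      by exists y.
    move=> /(congr1 p) /=; rewrite linear0 linearD linearB !ps subrr addr0.
    exact.
  apply: (retr _ _ u v) vN => l; apply: j_inj.
  by rewrite vE /= uE.
- move=> K X A i g [i_inj i_ex g_surj].
  move=> [K' [P [iK [gK [sesK pP vK]]]]] [A' [Q [iA [gA [sesA pQ vA]]]]].
  have [lam lamE] := pQ _ _ g gA g_surj.
  pose c : {linear (P * Q)%type -> X} := copair (i \o gK)%FUN lam.
  have [gK_surj gA_surj] : surjective gK /\ surjective gA.
    by split; [case: sesK | case: sesA].
  have c_surj : surjective c.
    move=> x; have [q qE] := gA_surj (g x).
    have /i_ex[k kE] : g (x - lam q) = 0 by rewrite linearB lamE qE subrr.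
    have [y yE] := gK_surj k.
    by exists (y, q); rewrite /= yE kE subrK.
  exists (ker c), (P * Q)%type, (ker_incl c), c.
  split; [exact: ker_ses | exact: projective_prod |].
  have [[iK_inj iK_ex _] [iA_inj iA_ex _]] := (sesK, sesA).
  have kerE (y : ker c) : let z := ker_incl c y in
      i (gK z.1) + lam z.2 = 0.
    by apply/(ker_incl_exact c); exists y.
  have [||k|u uE] := @ker_lift _ _ _ _ _ (ker_incl c) c (inl_lin P Q \o iK)%FUN.
  + exact: ker_incl_inj.
  + exact: ker_incl_exact.
  + by rewrite /= (exact_comp0 iK_ex) !linear0 addr0.
  have [//|//|y|v vE] := @ker_lift _ _ _ _ _ iA gA (snd_lin P Q \o ker_incl c)%FUN.
    have /(congr1 g) := kerE y; rewrite /= linear0 linearD (exact_comp0 i_ex).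
    by rewrite add0r lamE.
  apply: (ext _ _ _ u v) vK vA; split.
  + by move=> k k' /(congr1 (ker_incl _)); rewrite !uE => -[/iK_inj].
  + move=> y; split=> [y0|[k <-]]; last first.
      by apply: iA_inj; rewrite vE /= uE linear0.
    have y2 : (ker_incl c y).2 = 0 by rewrite -[LHS]vE y0 linear0.
    have /iK_ex[k kE] : gK (ker_incl c y).1 = 0.
      by apply: i_inj; have := kerE y; rewrite /= y2 !linear0 addr0.
    exists k; apply: ker_incl_inj; rewrite uE /= kE -y2.
    by rewrite -surjective_pairing.
  + move=> a'.
    have /i_ex[k kE] : g (lam (iA a')) = 0 by rewrite lamE (exact_comp0 iA_ex).
    have [y yE] := gK_surj (- k).
    have /(ker_incl_exact c)[z zE] : c (y, iA a') = 0.
      by rewrite /= yE linearN kE addNr.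
    by exists z; apply: iA_inj; rewrite vE /= zE.
Qed.

Lemma van_retract n A X (s : {linear A -> X}) (p : {linear X -> A}) :
  (forall a, p (s a) = a) -> van n X -> van n A.
Proof. by have [h _] := van_retract_middle n; apply: h. Qed.

Lemma van_middle n K X A (i : {linear K -> X}) (g : {linear X -> A}) :
  short_exact i g -> van n K -> van n A -> van n X.
Proof. by have [_ h] := van_retract_middle n; apply: h. Qed.

(** A fragment of the long exact sequence: degree n + 1 on K lies between degree
    n + 1 on X and degree n + 2 on A. *)
Lemma van_shift n K X A (i : {linear K -> X}) (g : {linear X -> A}) :
  short_exact i g -> van n.+1 A -> van n X -> van n K.
Proof. by have [retr ext] := van_retract_middle n; apply: van_shift_from. Qed.

(** The next fragment of the long exact sequence: degree n + 2 on A lies between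
    degree n + 1 on K and degree n + 2 on X. *)
Lemma van_unshift n K X A (i : {linear K -> X}) (g : {linear X -> A}) :
  short_exact i g -> van n K -> van n.+1 X -> van n.+1 A.
Proof.
move=> ses vK [L [P [j [q [ses_j pP vL]]]]].
have [j' [q' [ses' ses_n _ _]]] := ses_comp_ker ses ses_j.
exists (ker (g \o q)%FUN), P, (ker_incl (g \o q)%FUN), (g \o q)%FUN.
by split=> //; apply: van_middle ses' vL vK.
Qed.

End Derived.

(** * Vanishing of Ext *)

Section ResolutionShift.
Context (S : pzRingType).
Implicit Types (A K X : lmodType S).

Lemma syzygy_aug A (P : resolution A) :
  exists a : {linear P 1%N -> ker (res_aug P)},
    [/\ forall x, ker_incl (res_aug P) (a x) = res_d P 0 x,
        exact (res_d P 1) a & surjective a].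
Proof.
have [||x|a aE] := @ker_lift _ _ _ _ _ (ker_incl (res_aug P)) (res_aug P) (res_d P 0).
- exact: ker_incl_inj.
- exact: ker_incl_exact.
- exact/exact_comp0/res_exact0.
exists a; split=> // [x|k].
  rewrite -(res_exact x); split=> [ax|x0]; first by rewrite -aE ax linear0.
  by apply: ker_incl_inj; rewrite aE x0 linear0.
have /res_exact0[x xE] : res_aug P (ker_incl _ k) = 0.
  by apply/(ker_incl_exact (res_aug P)); exists k.
by exists x; apply: ker_incl_inj; rewrite aE.
Qed.

Definition syzygy_resolution A (P : resolution A)
    (a : {linear P 1%N -> ker (res_aug P)}) (ex : exact (res_d P 1) a)
    (surj : surjective a) : resolution (ker (res_aug P)) :=
  @Resolution S _ (fun i => P i.+1) (fun i => res_d P i.+1) a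
    (fun i => @res_exact _ _ P i.+1) ex surj.

Definition splice_obj (X : lmodType S) (F : nat -> lmodType S) (i : nat) :=
  if i is j.+1 then F j else X.

Definition splice_d K (P : resolution K) X (i : {linear K -> X}) (j : nat) :
    {linear splice_obj X P j.+1 -> splice_obj X P j} :=
  match j with
  | 0 => (i \o res_aug P)%FUN
  | k.+1 => res_d P k
  end.

Lemma splice_exact K (P : resolution K) X (i : {linear K -> X}) j :
  injective i -> exact (splice_d P i j.+1) (splice_d P i j).
Proof.
move=> inj; case: j => [|j]; last exact: res_exact.
move=> x; rewrite -[_ <-> _]/(_ <-> exists y, res_d P 0 y = x) -(res_exact0 x).
by split=> /= [ix|->]; [apply: inj; rewrite ix|]; rewrite linear0.
Qed.

Lemma splice_exact0 K (P : resolution K) X A (i : {linear K -> X})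
    (g : {linear X -> A}) : exact i g -> exact (splice_d P i 0) g.
Proof.
move=> ex x; rewrite (ex x); split=> [[k <-]|[y <-]].
  by have [y <-] := res_surj P k; exists y.
by exists (res_aug P y).
Qed.

Definition splice K (P : resolution K) X A (i : {linear K -> X})
    (g : {linear X -> A}) (inj : injective i) (ex : exact i g)
    (surj : surjective g) : resolution A :=
  @Resolution S _ (splice_obj X P) (splice_d P i) g
    (fun j => @splice_exact K P X i j inj) (@splice_exact0 K P X A i g ex) surj.

Definition cover A : {linear free_on A -> A} := projT1 (cid (free_onto_ex A)).

Lemma cover_surj A : surjective (cover A).
Proof. exact: projT2 (cid (free_onto_ex A)). Qed.

Fixpoint syzygy (i : nat) A : lmodType S :=
  if i is j.+1 then ker (cover (syzygy j A)) else A.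

Definition syzygy_d A i :
    {linear free_on (syzygy i.+1 A) -> free_on (syzygy i A)} :=
  (ker_incl (cover (syzygy i A)) \o cover (syzygy i.+1 A))%FUN.

Lemma syzygy_d_exact A i : exact (syzygy_d A i.+1) (syzygy_d A i).
Proof.
move=> x; split=> [dx|[y <-]]; last first.
  by rewrite /syzygy_d /= (exact_comp0 (@ker_incl_exact _ _ _ _)) linear0.
have /(ker_incl_exact (cover _))[k <-] : cover (syzygy i.+1 A) x = 0.
  by apply: ker_incl_inj; rewrite linear0.
by have [y <-] := cover_surj k; exists y.
Qed.

Lemma syzygy_d_exact0 A : exact (syzygy_d A 0) (cover A).
Proof.
move=> x; rewrite (ker_incl_exact (cover A) x); split=> [[k <-]|[y <-]].
  by have [y <-] := cover_surj k; exists y.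
by exists (cover (syzygy 1 A) y).
Qed.

Definition free_resolution A : resolution A :=
  Resolution (@syzygy_d_exact A) (@syzygy_d_exact0 A) (@cover_surj A).

End ResolutionShift.

Section Ext.
Context (S : pzRingType) (B : lmodType S).
Implicit Types (A E K L P X Y : lmodType S).

Definition extends K X (i : {linear K -> X}) : Prop :=
  forall f : {linear K -> B}, exists h : {linear X -> B}, forall k, h (i k) = f k.

Lemma extends_split K X (i : {linear K -> X}) (r : {linear X -> K}) :
  (forall k, r (i k) = k) -> extends i.
Proof. by move=> ri f; exists (f \o r)%FUN => k /=; rewrite ri. Qed.

Lemma extends_comp K X Y (i : {linear K -> X}) (j : {linear X -> Y})
    (k : {linear K -> Y}) :
  (forall x, k x = j (i x)) -> extends i -> extends j -> extends k.
Proof.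
move=> kE ei ej f; have [g gE] := ei f; have [h hE] := ej g.
by exists h => x; rewrite kE hE gE.
Qed.

Lemma extends_cancel K X Y (i : {linear K -> X}) (j : {linear X -> Y})
    (k : {linear K -> Y}) : (forall x, k x = j (i x)) -> extends k -> extends i.
Proof.
by move=> kE ek f; have [h hE] := ek f; exists (h \o j)%FUN => x /=; rewrite -kE.
Qed.

Lemma pushout_surj K' P X A (i' : {linear K' -> X}) (g' : {linear X -> A})
    (g : {linear P -> A}) (u : {linear P -> X}) :
  exact i' g' -> surjective g -> (forall p, g' (u p) = g p) ->
  surjective (copair u i').
Proof.
move=> ex surj ug x; have [p pE] := surj (g' x).
have /ex[k kE] : g' (x - u p) = 0 by rewrite linearB ug pE subrr.
by exists (p, k); rewrite /= kE addrC subrK.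
Qed.

(** The pushout square of a morphism of short exact sequences that is the
    identity on A, in the form K -> P + K' -> X. *)
Lemma pushout_exact K P K' X A (i : {linear K -> P}) (g : {linear P -> A})
    (i' : {linear K' -> X}) (g' : {linear X -> A})
    (u : {linear P -> X}) (v : {linear K -> K'}) :
  exact i g -> injective i' -> exact i' g' ->
  (forall p, g' (u p) = g p) -> (forall k, u (i k) = i' (v k)) ->
  forall z, copair u i' z = 0 <-> exists k, z = (i k, - v k).
Proof.
move=> ex inj' ex' ug uv [p k']; split=> /= [|[k [-> ->]]]; last first.
  by rewrite linearN uv subrr.
move=> /[dup] /(congr1 g'); rewrite linear0 linearD ug (exact_comp0 ex') addr0.
move=> /ex[k <-]; rewrite uv -linearD => /eqP; rewrite -(linear0 i') => /eqP/inj'.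
by move=> /eqP; rewrite addrC addr_eq0 => /eqP ->; exists k.
Qed.

Lemma extends_pushout K P K' X A (i : {linear K -> P}) (g : {linear P -> A})
    (i' : {linear K' -> X}) (g' : {linear X -> A})
    (u : {linear P -> X}) (v : {linear K -> K'}) :
  short_exact i g -> short_exact i' g' ->
  (forall p, g' (u p) = g p) -> (forall k, u (i k) = i' (v k)) ->
  extends i -> extends i'.
Proof.
move=> [inj ex surj] [inj' ex' surj'] ug uv ei f.
have [w wE] := ei (f \o v)%FUN.
have [z|h hE] := coker_lift (h := copair w f) (pushout_surj ex' surj ug).
  move=> /(pushout_exact ex inj' ex' ug uv)[k ->] /=.
  by rewrite wE linearN subrr.
exists h => k; have := hE (0, k); rewrite /= !linear0 !add0r; exact.
Qed.

Definition ext_van (n : nat) A : Prop := van (@extends) n A.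

Definition ext_shift := van_shift extends_split extends_comp extends_cancel.
Definition ext_unshift :=
  van_unshift extends_split extends_comp extends_cancel.
Definition ext_middle := van_middle extends_split extends_comp extends_cancel.
Definition ext_retract := van_retract extends_split extends_comp extends_cancel.
Definition ext_cover := van1_of_cover extends_pushout.
Definition ext_projective := van_projective extends_split.

(** A cocycle on P_{n+1} is a map defined on the syzygy in degree n + 1. *)
Lemma ext_of_resolution n A (P : resolution A) : (forall i, projective (P i)) ->
  (forall f : {linear P n.+1 -> B}, (forall x, f (res_d P n.+1 x) = 0) ->
     exists g : {linear P n -> B}, forall x, g (res_d P n x) = f x) ->
  ext_van n A.
Proof.
elim: n A P => [|n IHn] A P pP hP; have [a [aE a_ex a_surj]] := syzygy_aug P.
  apply: (ext_cover (ker_ses (res_surj P)) (pP 0%N)) => f.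
  have [x|g gE] := hP (f \o a)%FUN; first by rewrite /= (exact_comp0 a_ex) linear0.
  by exists g => k; have [x <-] := a_surj k; rewrite aE gE.
exists (ker (res_aug P)), (P 0%N), (ker_incl _), (res_aug P).
split; [exact/ker_ses/res_surj | exact: pP |].
by apply: (IHn _ (syzygy_resolution a_ex a_surj)) => [i|]; [apply: pP | apply: hP].
Qed.

Lemma ext_vanP n A : ext_van n A <-> Ext_zero n.+1 A B.
Proof.
split=> [|[P [pP hP]]]; last exact: ext_of_resolution hP.
elim: n A => [|n IHn] A.
  move=> vA; pose P := free_resolution A.
  exists P; split=> [i|f fd]; first exact: projective_free.
  have [a [aE a_ex a_surj]] := syzygy_aug P.
  have [x /a_ex[y <-]|f' f'E] := coker_lift (h := f) a_surj; first exact: fd.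
  have [h hE] := vA _ _ _ _ (ker_ses (res_surj P)) f'.
  by exists h => x; rewrite -aE hE.
move=> [K [X [i [g [[inj ex surj] pX /IHn[P [pP hP]]]]]]].
exists (splice P inj ex surj); split; last exact: hP.
by case=> [|j]; [apply: pX | apply: pP].
Qed.

(** The start of the long exact sequence: Ext^1(A, B) lies between
    Coker (Hom(X, B) -> Hom(K, B)) and Ext^1(X, B). *)
Lemma ext_unshift0 K X A (i : {linear K -> X}) (g : {linear X -> A}) :
  short_exact i g -> extends i -> ext_van 0 X -> ext_van 0 A.
Proof.
move=> ses ei vX L E j q ses_j f.
have [i1 [ses1 i1E i10]] := pb_ses2 g ses_j.
have [i2 [[_ ex2 surj2] i2E _]] := pb_ses1 q ses.
have [h hE] := vX _ _ _ _ ses1 f.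
have [u uE] := ei (h \o i2)%FUN.
have [e /ex2[k <-]|w wE] := coker_lift (h := (h \- (u \o pb1 g q))%R) surj2.
  by rewrite -[LHS]/(h (i2 k) - u (pb1 g q (i2 k))) i2E uE subrr.
exists w => l; rewrite -i1E wE -[LHS]/(h (i1 l) - u (pb1 g q (i1 l))).
by rewrite i10 linear0 subr0.
Qed.

(** Lifting along E -> Y: the obstruction lies in Ext^1(A, B). *)
Lemma ext_lift A E Y (i : {linear B -> E}) (g : {linear E -> Y})
    (f : {linear A -> Y}) :
  ext_van 0 A -> short_exact i g -> exists h : {linear A -> E}, forall a, g (h a) = f a.
Proof.
move=> vA ses; have [j [ses_j jE j0]] := pb_ses1 f ses.
have [r rE] := vA _ _ _ _ ses_j idfun.
have [_ j_ex surj] := ses_j; have [_ ex _] := ses.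
have [e /j_ex[k <-]|h hE] := coker_lift (h := (pb1 g f \- (i \o r))%R) surj.
  by rewrite -[LHS]/(pb1 g f (j k) - i (r (j k))) rE jE subrr.
exists h => a; have [e <-] := surj a.
by rewrite hE linearB (exact_comp0 ex) subr0 pbE.
Qed.

(** Ext^1 turns direct sums into products because extensions of maps can be
    chosen on each summand; higher degrees follow from the direct sum of a
    projective cover. *)
Lemma ext_dsum n I A : ext_van n A -> ext_van n (dsum I A).
Proof.
have [K [P [i [g [pP ses]]]]] := projective_cover A.
elim: n A K P i g pP ses => [|n IHn] A K P i g pP ses vA.
  apply: (ext_cover (dsum_ses I ses) (projective_dsum (I := I) pP)) => f.
  have /choice[h hE] j : exists h : {linear P -> B}, forall k, h (i k) = f (single j k).
    exact: (vA _ _ _ _ ses (f \o single j)%FUN).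
  have [H HE] := dsum_lift h; exists H => k.
  apply: (dsum_hom_eq (u := (H \o dsum_map I i)%FUN)) => j x.
  by rewrite -[LHS]/(H (dsum_map I i (single j x))) dsum_map_single HE hE.
exists (dsum I K), (dsum I P), (dsum_map I i), (dsum_map I g).
split; [exact: dsum_ses | exact: projective_dsum |].
have [K' [P' [i' [g' [pP' ses']]]]] := projective_cover K.
by apply: (IHn _ _ _ _ _ pP' ses'); apply: ext_shift ses vA (ext_projective _ pP).
Qed.

End Ext.

(** Dimension shifting in the second variable: Ext^{n+1}(A, N) lies between
    Ext^{n+1}(A, N'') and Ext^{n+2}(A, N'). *)
Lemma ext_shift_coef (S : pzRingType) n (A N' N'' N : lmodType S)
    (i : {linear N' -> N''}) (g : {linear N'' -> N}) : short_exact i g ->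
  ext_van N'' n A -> ext_van N' n.+1 A -> ext_van N n A.
Proof.
move=> ses; elim: n A => [|n IHn] A vA [K [P [j [q [ses_j pP vK]]]]].
  apply: (ext_cover ses_j pP) => f.
  have [f' f'E] := ext_lift f vK ses.
  have [h hE] := vA _ _ _ _ ses_j f'.
  by exists (g \o h)%FUN => k /=; rewrite hE f'E.
exists K, P, j, q; split=> //; apply: IHn => //.
exact: ext_shift ses_j vA (ext_projective _ _ pP).
Qed.

(** * Vanishing of Tor *)

Section Tensor.
Context (R : pzRingType) (M : bimodType R).
Implicit Types (A K X Y Z P : lmodType R).

Lemma tensor_ind X (Q : tensor M X -> Prop) :
  Q 0 -> (forall t u, Q t -> Q u -> Q (t + u)) -> (forall m x, Q (tens m x)) ->
  forall t, Q t.
Proof.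
move=> Q0 QD Qt; elim/tensor_class_ind; elim=> [|[m x] s IHs]; first exact: Q0.
rewrite -cat1s tens_class_cat; apply: QD => //; exact: Qt.
Qed.

Lemma tmap_tens X Y (g : {linear X -> Y}) m x : tmap M g (tens m x) = tens m (g x).
Proof. by apply: tlift_tens; apply: tmap_balanced. Qed.

Lemma tensor_hom_eq X Y (f g : {linear tensor M X -> Y}) :
  (forall m x, f (tens m x) = g (tens m x)) -> forall t, f t = g t.
Proof.
move=> fg; elim/tensor_ind => //; first by rewrite !linear0.
by move=> t u ft fu; rewrite !linearD ft fu.
Qed.

Lemma tmap_comp X Y Z (f : {linear X -> Y}) (g : {linear Y -> Z}) (h : {linear X -> Z}) :
  (forall x, h x = g (f x)) -> forall t, tmap M h t = tmap M g (tmap M f t).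
Proof.
move=> hE; apply: (tensor_hom_eq (g := (tmap M g \o tmap M f)%FUN)) => m x /=.
by rewrite !tmap_tens hE.
Qed.

Lemma tmap_id X (h : {linear X -> X}) :
  (forall x, h x = x) -> forall t, tmap M h t = t.
Proof.
move=> hE; apply: (tensor_hom_eq (g := idfun)) => m x /=.
by rewrite !tmap_tens hE.
Qed.

Lemma tmap_zero X Y (h : {linear X -> Y}) :
  (forall x, h x = 0) -> forall t, tmap M h t = 0.
Proof.
move=> hE; apply: (tensor_hom_eq (g := zero_lin _ _)) => m x /=.
by rewrite !tmap_tens hE; apply: (addIr (tens m 0)); rewrite -tensDr !add0r.
Qed.

Lemma tmap_surj X Y (g : {linear X -> Y}) : surjective g -> surjective (tmap M g).
Proof.
move=> gs; elim/tensor_ind; first by exists 0; apply: linear0.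
  by move=> _ _ [t <-] [u <-]; exists (t + u); rewrite linearD.
by move=> m y; have [x <-] := gs y; exists (tens m x); rewrite tmap_tens.
Qed.

Lemma tensB m X (x y : X) : tens m (x - y) = tens m x - tens m y :> tensor M X.
Proof. by apply: (addIr (tens m y)); rewrite -tensDr !subrK. Qed.

(** The inverse of coker (M (x) f) -> M (x) Z is induced by m (x) g y |-> m (x) y. *)
Lemma tmap_exact X Y Z (f : {linear X -> Y}) (g : {linear Y -> Z}) :
  exact f g -> surjective g -> exact (tmap M f) (tmap M g).
Proof.
move=> ex gs t; split=> [gt|[u <-]]; last first.
  rewrite -(tmap_comp (h := zero_lin X Z)) ?tmap_zero // => x.
  by rewrite (exact_comp0 ex).
pose q := coker_proj (tmap M f).
have [s sE] := choice gs.
have qs m y y' : g y = g y' -> q (tens m y) = q (tens m y').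
  move=> gy; apply/subr0_eq; rewrite -linearB -tensB.
  have /ex[x <-] : g (y - y') = 0 by rewrite linearB gy subrr.
  by rewrite -tmap_tens; apply/(coker_proj_exact (tmap M f)); eexists.
have bal : balanced (fun m z => q (tens m (s z))).
  split=> [m1 m2 z|m z1 z2|m r z]; first by rewrite tensDl linearD.
    by rewrite -linearD -tensDr; apply: qs; rewrite linearD !sE.
  by rewrite tens_balanced; apply: qs; rewrite linearZ_LR !sE.
have lin : linear (tlift (fun m z => q (tens m (s z)))).
  by apply: tlift_linear => // r m z; rewrite -tensZ linearZ_LR.
apply/(coker_proj_exact (tmap M f)); rewrite -/q.
have <- : mk_lin lin (tmap M g t) = q t.
  apply: (tensor_hom_eq (f := (mk_lin lin \o tmap M g)%FUN)) => m y /=.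
  by rewrite tmap_tens tlift_tens //; apply: qs; rewrite sE.
by rewrite gt linear0.
Qed.

Definition tens_inj K X (i : {linear K -> X}) : Prop := injective (tmap M i).

Lemma tens_inj_split K X (i : {linear K -> X}) (r : {linear X -> K}) :
  (forall k, r (i k) = k) -> tens_inj i.
Proof.
move=> ri; apply: (can_inj (g := tmap M r)) => t.
rewrite -(tmap_comp (h := (r \o i)%FUN)) //; exact: tmap_id.
Qed.

Lemma tens_inj_comp K X Y (i : {linear K -> X}) (j : {linear X -> Y})
    (k : {linear K -> Y}) :
  (forall x, k x = j (i x)) -> tens_inj i -> tens_inj j -> tens_inj k.
Proof.
by move=> kE ei ej t u; rewrite !(tmap_comp kE) => /ej/ei.
Qed.

Lemma tens_inj_cancel K X Y (i : {linear K -> X}) (j : {linear X -> Y})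
    (k : {linear K -> Y}) : (forall x, k x = j (i x)) -> tens_inj k -> tens_inj i.
Proof. by move=> kE ek t u tu; apply: ek; rewrite !(tmap_comp kE) tu. Qed.

Lemma tens_inj_pushout K P (K' : lmodType R) X A (i : {linear K -> P}) (g : {linear P -> A})
    (i' : {linear K' -> X}) (g' : {linear X -> A})
    (u : {linear P -> X}) (v : {linear K -> K'}) :
  short_exact i g -> short_exact i' g' ->
  (forall p, g' (u p) = g p) -> (forall k, u (i k) = i' (v k)) ->
  tens_inj i -> tens_inj i'.
Proof.
move=> [inj ex surj] [inj' ex' surj'] ug uv ei.
apply: linear_inj0 => t t0.
pose w : {linear K -> (P * K')%type} := (inl_lin P K' \o i \- (inr_lin P K' \o v))%R.
have wex : exact w (copair u i').
  move=> z; rewrite (pushout_exact ex inj' ex' ug uv).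
  by split=> [[k ->]|[k <-]]; exists k; congr pair; rewrite /= ?subr0 ?sub0r.
have /(tmap_exact wex (pushout_surj ex' surj ug))[k kE] :
    tmap M (copair u i') (tmap M (inr_lin P K') t) = 0.
  by rewrite -(tmap_comp (h := i')) // => x; rewrite /= linear0 add0r.
have k0 : k = 0.
  apply: ei; rewrite linear0 (tmap_comp (f := w) (g := fst_lin P K')).
    rewrite kE -(tmap_comp (h := zero_lin _ _)) //; exact: tmap_zero.
  by move=> x; rewrite /= subr0.
rewrite k0 linear0 in kE.
have := congr1 (tmap M (snd_lin P K')) kE; rewrite linear0.
by rewrite -(tmap_comp (h := idfun)) // tmap_id.
Qed.

Definition tor_van (n : nat) A : Prop := van (@tens_inj) n A.

Definition tor_shift := van_shift tens_inj_split tens_inj_comp tens_inj_cancel.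
Definition tor_cover := van1_of_cover tens_inj_pushout.
Definition tor_projective := van_projective tens_inj_split.

(** M (x) - is right exact, so M (x) P_{n+1} maps onto the tensor product of M
    with the syzygy in degree n + 1, with kernel the image of M (x) P_{n+2}. *)
Lemma tor_of_resolution n A (P : resolution A) : (forall i, projective (P i)) ->
  exact (tmap M (res_d P n.+1)) (tmap M (res_d P n)) -> tor_van n A.
Proof.
elim: n A P => [|n IHn] A P pP hP; have [a [aE a_ex a_surj]] := syzygy_aug P.
  apply: (tor_cover (ker_ses (res_surj P)) (pP 0%N)); apply: linear_inj0 => t t0.
  have [u uE] := tmap_surj a_surj t; move: t0; rewrite -uE /=.
  rewrite -(tmap_comp (h := res_d P 0)) => [/hP[s <-]|x]; last by rewrite aE.
  by apply/(tmap_exact a_ex a_surj); exists s.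
exists (ker (res_aug P)), (P 0%N), (ker_incl _), (res_aug P).
split; [exact/ker_ses/res_surj | exact: pP |].
by apply: (IHn _ (syzygy_resolution a_ex a_surj)) => [i|]; [apply: pP | apply: hP].
Qed.

Lemma tor_vanP n A : Tor_zero n.+1 M A -> tor_van n A.
Proof. by move=> [P [pP hP]]; apply: tor_of_resolution hP. Qed.

End Tensor.

(** * Modules over the trivial extension *)

(** An action of the square-zero ideal on an R-module: the pair (X, alpha)
    before the tensor product is formed. *)
Record ideal_action (R : pzRingType) (M : bimodType R) (X : lmodType R) := IdealAction {
  act :> M -> X -> X;
  actDl : forall m1 m2 x, act (m1 + m2) x = act m1 x + act m2 x;
  actDr : forall m x1 x2, act m (x1 + x2) = act m x1 + act m x2;
  actR : forall m r x, act (m *< r) x = act m (r *: x);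
  actZ : forall r m x, act (r *: m) x = r *: act m x;
  act_act : forall m1 m2 x, act m1 (act m2 x) = 0
}.

Section ExtensionModule.
Context (R : pzRingType) (M : bimodType R) (X : lmodType R) (a : ideal_action M X).

Definition action_mod of ideal_action M X : Type := X.
Local Notation Z := (action_mod a).
HB.instance Definition _ := GRing.Zmodule.on Z.

Definition action_scale (s : trivext M) (x : Z) : Z := s.1 *: (x : X) + a s.2 x.

Lemma act0l x : a 0 x = 0.
Proof. by apply: (addIr (a 0 x)); rewrite -actDl !add0r. Qed.

Lemma action_scaleA s t x : action_scale s (action_scale t x) = action_scale (s * t) x.
Proof.
rewrite /action_scale scalerDr scalerA actDr act_act addr0 -addrA.
by congr (_ + _); rewrite actDl actZ actR.
Qed.

Lemma action_scale1 : left_id 1 action_scale.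
Proof. by move=> x; rewrite /action_scale scale1r act0l addr0. Qed.

Lemma action_scaleDr : right_distributive action_scale +%R.
Proof. by move=> s x y; rewrite /action_scale scalerDr actDr addrACA. Qed.

Lemma action_scaleDl x : {morph action_scale^~ x : s t / s + t}.
Proof. by move=> s t; rewrite /action_scale scalerDl actDl addrACA. Qed.

HB.instance Definition _ := GRing.Zmodule_isLmodule.Build (trivext M) Z
  action_scaleA action_scale1 action_scaleDr action_scaleDl.

Lemma to_base_linear : linear (fun x : X => x : base (Z : lmodType (trivext M))).
Proof. by move=> r x y; rewrite -[_ *: _ in RHS]/(r *: x + a 0 x) act0l addr0. Qed.

Lemma of_base_linear : linear (fun x : base (Z : lmodType (trivext M)) => x : X).
Proof. by move=> r x y; rewrite -[_ *: _ in LHS]/(r *: (x : X) + a 0 x) act0l addr0. Qed.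

Definition to_base : {linear X -> base (Z : lmodType (trivext M))} :=
  mk_lin to_base_linear.
Definition of_base : {linear base (Z : lmodType (trivext M)) -> X} :=
  mk_lin of_base_linear.

Lemma ideal_actE m (x : X) : ideal_act m (to_base x) = a m x.
Proof. by rewrite -[LHS]/(0 *: x + a m x) scale0r add0r. Qed.

Lemma base_iso : iso X (base (Z : lmodType (trivext M))).
Proof. by exists to_base; exists of_base. Qed.

End ExtensionModule.
Arguments to_base {R M X} a.
Arguments of_base {R M X} a.

Section BaseMap.
Context (R : pzRingType) (M : bimodType R).
Implicit Types (A K X Y Z : lmodType (trivext M)).

Lemma bmap_linear X Y (f : {linear X -> Y}) : linear (fun x : base X => f x : base Y).
Proof. by move=> r x y; rewrite linearP. Qed.

Definition bmap X Y (f : {linear X -> Y}) : {linear base X -> base Y} :=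
  mk_lin (bmap_linear f).

Lemma bmap_act X Y (f : {linear X -> Y}) m (x : base X) :
  bmap f (ideal_act m x) = ideal_act m (bmap f x).
Proof. by rewrite /= /ideal_act linearZ_LR. Qed.

Lemma bmap_ses K X A (i : {linear K -> X}) (g : {linear X -> A}) :
  short_exact i g -> short_exact (bmap i) (bmap g).
Proof. by []. Qed.

(** The ring S is generated additively by R and M. *)
Lemma act_linear X Y (f : {linear base X -> base Y}) :
  (forall m x, f (ideal_act m x) = ideal_act m (f x)) -> linear (f : X -> Y).
Proof.
move=> fact s x y.
have sE (W : lmodType (trivext M)) (w : W) :
    s *: w = s.1 *: (w : base W) + ideal_act s.2 (w : base W).
  rewrite -[RHS](scalerDl (w : W)); congr (_ *: _).
  by case: s => r m; congr pair; rewrite /= ?addr0 ?add0r.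
rewrite !sE -[X in f X]/((s.1 *: (x : base X) + ideal_act s.2 (x : base X)) + (y : base X)).
by rewrite !linearD linearZ_LR fact.
Qed.

Lemma ideal_act_act X m m' (x : base X) : ideal_act m (ideal_act m' x) = 0.
Proof.
rewrite /ideal_act scalerA.
have -> : in_ideal m * in_ideal m' = 0 :> trivext M.
  by congr pair; rewrite /= ?mul0r // scale0r rscale0r addr0.
exact: scale0r.
Qed.

Lemma alpha_tens Z m (x : base Z) : alpha Z (tens m x) = ideal_act m x.
Proof.
apply: tlift_tens.
by split; [exact: ideal_actDl | exact: ideal_actDr | exact: ideal_actR].
Qed.

Lemma ideal_act0 Z m : ideal_act m (0 : base Z) = 0.
Proof. by apply: (addIr (ideal_act m 0)); rewrite -ideal_actDr !add0r. Qed.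

Lemma alpha0 Z : alpha Z 0 = 0.
Proof. exact: (linear0 (alpha Z : {linear tensor M (base Z) -> base Z})). Qed.

Lemma alphaD Z t u : alpha Z (t + u) = alpha Z t + alpha Z u.
Proof. exact: (linearD (alpha Z : {linear tensor M (base Z) -> base Z})). Qed.

Lemma alpha_nat X Y (f : {linear X -> Y}) t :
  bmap f (alpha X t) = alpha Y (tmap M (bmap f) t).
Proof.
apply: (tensor_hom_eq (f := (bmap f \o alpha X)%FUN)
  (g := (alpha Y \o tmap M (bmap f))%FUN)) => m x.
rewrite -[LHS]/(bmap f (alpha X (tens m x))) -[RHS]/(alpha Y (tmap M (bmap f) (tens m x))).
by rewrite tmap_tens !alpha_tens bmap_act.
Qed.

End BaseMap.

(** ** The R-module X with zero action *)

Section ZeroAction.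
Context (R : pzRingType) (M : bimodType R) (X : lmodType R).

Program Definition zero_action : ideal_action M X := @IdealAction R M X (fun _ _ => 0) _ _ _ _ _.
Next Obligation. by rewrite addr0. Qed.
Next Obligation. by rewrite addr0. Qed.
Next Obligation. by rewrite scaler0. Qed.

Definition triv : lmodType (trivext M) := action_mod zero_action.

End ZeroAction.

(** ** Coinduced modules *)

Section Coinduced.
Context (R : pzRingType) (M : bimodType R) (Y : lmodType R).

Definition coind_act (m : M) (p : Y * modHom M Y) : Y * modHom M Y :=
  (hom_fun p.2 m, 0).

Program Definition coind_action : ideal_action M (Y * modHom M Y)%type :=
  @IdealAction R M (Y * modHom M Y)%type coind_act _ _ _ _ _.
Next Obligation. by congr pair; rewrite /= ?addr0 ?linearD. Qed.
Next Obligation. by congr pair; rewrite /= ?addr0. Qed.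
Next Obligation. by congr pair; rewrite /= ?scaler0 ?linearZ_LR. Qed.

(** Hom_R(S, Y), with S = R + M as a left R-module. *)
Definition coind : lmodType (trivext M) := action_mod coind_action.

(** F z is the map (r, m) |-> f ((r, m) z). *)
Lemma coind_adjoint (Z : lmodType (trivext M)) (f : {linear base Z -> Y}) :
  exists F : {linear Z -> coind}, forall z, (F z : Y * modHom M Y).1 = f z.
Proof.
pose p : {linear base Z -> (Y * modHom M Y)%type} := pair_lin f (hmap M f \o beta Z)%FUN.
pose F : {linear base Z -> base coind} := (to_base coind_action \o p)%FUN.
have Fl : linear (F : Z -> coind).
  apply: act_linear => m z; rewrite [RHS]ideal_actE.
  congr pair; apply: hom_ext => m' /=.
  by rewrite ideal_act_act linear0.
by exists (mk_lin Fl).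
Qed.

Lemma coind_extends (K Z : lmodType (trivext M)) (i : {linear K -> Z}) :
  extends coind i -> extends Y (bmap i).
Proof.
move=> ei f; have [F FE] := coind_adjoint f; have [H HE] := ei F.
exists (fst_lin Y (modHom M Y) \o of_base coind_action \o bmap H)%FUN => k.
by rewrite -FE -HE.
Qed.

End Coinduced.

(** A free module over the extension is, over R, a direct sum of copies of
    R + M, so that Ext vanishes on it as soon as it vanishes on M. *)
Section FreeBase.
Context (R : pzRingType) (M : bimodType R) (Y : lmodType R).
Local Notation S := (trivext M).
Local Notation S1 := (S^o : lmodType S).

Lemma base_ring_scale r (x : base S1) :
  r *: x = (r * (x : S).1, r *: (x : S).2) :> S.
Proof.
by rewrite -[LHS]/((r * (x : S).1, r *: (x : S).2 + (0 : M) *< (x : S).1) : S) rscale0l addr0.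
Qed.

Lemma ring_of_base_linear :
  linear (fun x : base S1 => (x : S) : (R^o * M : lmodType R)%type).
Proof. by move=> r x y; rewrite [r *: x]base_ring_scale. Qed.

Lemma base_of_ring_linear :
  linear (fun x : (R^o * M : lmodType R)%type => (x : S) : base S1).
Proof. by move=> r x y; rewrite [_ *: _ in RHS]base_ring_scale. Qed.

Lemma ext_base_ring n : ext_van Y n M -> ext_van Y n (base S1).
Proof.
move=> vM; apply: (ext_retract (s := mk_lin ring_of_base_linear)
  (p := mk_lin base_of_ring_linear)) => //.
have ses : short_exact (inl_lin R^o M) (snd_lin R^o M).
  split=> [x y []//|[x m]|m]; last by exists (0, m).
  by split=> /= [->|[y [_ <-]] //]; first by exists x.
exact: ext_middle ses (ext_projective _ _ (@projective_ring R)) vM.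
Qed.

Lemma dsum_of_base_linear I :
  linear (fun f : base (dsum I S1) => f : dsum I (base S1)).
Proof. by move=> r f g; apply: coeff_ext. Qed.

Lemma base_of_dsum_linear I :
  linear (fun f : dsum I (base S1) => f : base (dsum I S1)).
Proof. by move=> r f g; apply: (@coeff_ext _ I S1). Qed.

Lemma ext_base_free n I : ext_van Y n M -> ext_van Y n (base (dsum I S1)).
Proof.
move=> vM; apply: (ext_retract (s := mk_lin (@dsum_of_base_linear I))
  (p := mk_lin (@base_of_dsum_linear I))) => //.
exact/ext_dsum/ext_base_ring.
Qed.

End FreeBase.

(** Change of rings along R -> S: restriction is exact with right adjoint the
    coinduction, and turns free modules into modules on which Ext vanishes. *)
Lemma ext_coinduced (R : pzRingType) (M : bimodType R) (Y : lmodType R) n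
    (Z : lmodType (trivext M)) :
  (forall j, (j <= n)%N -> ext_van Y j M) -> ext_van (coind M Y) n Z ->
  ext_van Y n (base Z).
Proof.
elim: n Z => [|n IHn] Z vM vZ.
  have ses := ker_ses (@cover_surj _ Z).
  apply: (ext_unshift0 (bmap_ses ses)); last exact: ext_base_free (vM _ (leqnn _)).
  exact: coind_extends (vZ _ _ _ _ ses).
have ses := ker_ses (@cover_surj _ Z).
apply: (ext_unshift (bmap_ses ses)); last exact: ext_base_free (vM _ (leqnn _)).
apply: IHn => [j jn|]; first exact/vM/leqW.
apply: ext_shift ses vZ _; exact/ext_projective/projective_free.
Qed.

(** ** Induced modules *)

Section Induced.
Context (R : pzRingType) (M : bimodType R).
Implicit Types (X Y K A P : lmodType R).

Definition ind_act X (m : M) (p : X * tensor M X) : X * tensor M X :=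
  (0, tens m p.1).

Program Definition ind_action X : ideal_action M (X * tensor M X)%type :=
  @IdealAction R M (X * tensor M X)%type (@ind_act X) _ _ _ _ _.
Next Obligation. by congr pair; rewrite /= ?addr0 ?tensDl. Qed.
Next Obligation. by congr pair; rewrite /= ?addr0 ?tensDr. Qed.
Next Obligation. by congr pair; rewrite /= tens_balanced. Qed.
Next Obligation. by congr pair; rewrite /= ?scaler0 ?tensZ. Qed.
Next Obligation.
by congr pair; apply: (addIr (tens m1 0)); rewrite -tensDr !add0r.
Qed.

(** S (x)_R X, with S = R + M as a right R-module. *)
Definition ind X : lmodType (trivext M) := action_mod (ind_action X).

Lemma ind_actE X m x t :
  ideal_act m ((x, t) : base (ind X)) = ((0, tens m x) : base (ind X)).
Proof. exact: (ideal_actE (ind_action X) m (x, t)). Qed.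

Lemma base_of_ind_linear X : linear (fun x : X => (x, 0) : base (ind X)).
Proof.
move=> r x y; rewrite -[RHS](linearP (to_base (ind_action X)) r (x, 0) (y, 0)) /=.
by congr pair; rewrite /= scaler0 addr0.
Qed.
Definition to_ind X : {linear X -> base (ind X)} := mk_lin (@base_of_ind_linear X).

Lemma ind_adjoint X (Z : lmodType (trivext M)) (f : {linear X -> base Z}) :
  exists F : {linear ind X -> Z}, forall p : X * tensor M X,
    F p = f p.1 + alpha Z (tmap M f p.2).
Proof.
pose F : {linear base (ind X) -> base Z} :=
  (copair f (alpha Z \o tmap M f) \o of_base (ind_action X))%FUN.
have act_alpha m t : ideal_act m (alpha Z t) = 0.
  elim/tensor_ind: t => [|t u ht hu|m' x].
  - by rewrite alpha0 ideal_act0.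
  - by rewrite alphaD ideal_actDr ht hu addr0.
  - by rewrite alpha_tens ideal_act_act.
have Fl : linear (F : ind X -> Z).
  apply: act_linear => m [x t]; rewrite ind_actE /=.
  rewrite linear0 add0r tmap_tens ideal_actDr act_alpha addr0.
  exact: alpha_tens.
by exists (mk_lin Fl).
Qed.

Lemma ind_hom_eq X (Z : lmodType (trivext M)) (F G : {linear ind X -> Z}) :
  (forall x, bmap F (to_ind X x) = bmap G (to_ind X x)) -> forall p, F p = G p.
Proof.
move=> FG.
pose jr : {linear tensor M X -> base (ind X)} :=
  (to_base (ind_action X) \o inr_lin X (tensor M X))%FUN.
have FGt t : bmap F (jr t) = bmap G (jr t).
  apply: (tensor_hom_eq (f := (bmap F \o jr)%FUN) (g := (bmap G \o jr)%FUN)) => m x.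
  have jE : jr (tens m x) = ideal_act m (to_ind X x) by rewrite [RHS]ideal_actE.
  by rewrite -[LHS]/(bmap F (jr _)) -[RHS]/(bmap G (jr _)) jE !bmap_act FG.
move=> [x t].
have -> : (x, t) = to_ind X x + jr t :> base (ind X).
  by rewrite -[RHS]/((x + 0, 0 + t) : base (ind X)) addr0 add0r.
by rewrite -[LHS]/(bmap F (to_ind X x + jr t)) -[RHS]/(bmap G (to_ind X x + jr t)) !linearD FG FGt.
Qed.

(** A left adjoint of an exact functor preserves projective modules. *)
Lemma projective_ind P : projective P -> projective (ind P).
Proof.
move=> pP X Y g f gs.
have [h hE] := pP _ _ (bmap g) (bmap f \o to_ind P)%FUN gs.
have [H HE] := ind_adjoint h; exists H.
apply: (ind_hom_eq (F := (g \o H)%FUN)) => x.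
have Hx : H (x, 0) = h x by rewrite HE /= linear0 alpha0 addr0.
by rewrite -[LHS]/(bmap g (H (x, 0))) Hx hE.
Qed.

Section IndMap.
Context (X Y : lmodType R) (f : {linear X -> Y}).

Definition ind_base_map : {linear base (ind X) -> base (ind Y)} :=
  (to_base (ind_action Y) \o pair_lin (f \o fst_lin X (tensor M X))
     (tmap M f \o snd_lin X (tensor M X)) \o of_base (ind_action X))%FUN.

Lemma ind_map_linear : linear (ind_base_map : ind X -> ind Y).
Proof.
apply: act_linear => m [x t].
rewrite ind_actE [RHS]ind_actE.
by congr pair; rewrite /= ?linear0 ?tmap_tens.
Qed.

Definition ind_map : {linear ind X -> ind Y} := mk_lin ind_map_linear.

Lemma ind_mapE x t : ind_map (x, t) = (f x, tmap M f t) :> Y * tensor M Y.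
Proof. by []. Qed.

End IndMap.

Lemma ind_ses K X A (i : {linear K -> X}) (g : {linear X -> A}) :
  short_exact i g -> tens_inj M i -> short_exact (ind_map i) (ind_map g).
Proof.
move=> [inj ex surj] tinj; split.
- by move=> [k t] [k' t']; rewrite !ind_mapE => -[/inj -> /tinj ->].
- move=> [x t]; rewrite ind_mapE; split=> [[/ex[k <-] /(tmap_exact ex surj)[u <-]]|].
    by exists (k, u).
  move=> [[k u]]; rewrite ind_mapE => -[<- <-].
  congr pair; first exact: exact_comp0 ex k.
  exact: exact_comp0 (tmap_exact ex surj) u.
- move=> [a t]; have [[x xE] [u uE]] := (surj a, tmap_surj (M := M) surj t).
  by exists (x, u); rewrite ind_mapE xE uE.
Qed.

Lemma ind_extends Y K X (i : {linear K -> X}) :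
  extends (triv M Y) (ind_map i) -> extends Y i.
Proof.
move=> ei f; have [F FE] := ind_adjoint (to_base (zero_action M Y) \o f)%FUN.
have [H HE] := ei F.
exists (of_base (zero_action M Y) \o bmap H \o to_ind X)%FUN => k.
have Fk : F (k, 0) = f k by rewrite FE /= linear0 alpha0 addr0.
have ik : ind_map i (k, 0) = ((i k, 0) : ind X).
  by congr pair; exact: (linear0 (tmap M i : {linear tensor M K -> tensor M X})).
by rewrite -Fk -HE ik.
Qed.

(** Change of rings along R -> S: the induction is left adjoint to restriction,
    preserves projective modules, and is exact where Tor vanishes. *)
Lemma ext_induced Y n A : (forall j, (j <= n)%N -> tor_van M j A) ->
  ext_van (triv M Y) n (ind A) -> ext_van Y n A.
Proof.
elim: n A => [|n IHn] A tA vA;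
  have [K [P [i [g [pP ses]]]]] := projective_cover A;
  have sesI := ind_ses ses (tA 0%N isT _ _ _ _ ses).
  exact: ext_cover ses pP (ind_extends (vA _ _ _ _ sesI)).
exists K, P, i, g; split=> //; apply: IHn => [j jn|].
  exact: tor_shift ses (tA j.+1 jn) (tor_projective _ _ pP).
exact: ext_shift sesI vA (ext_projective _ _ (projective_ind pP)).
Qed.

End Induced.

(** * Finite resolutions *)

Section FiniteResolutions.
Context (S : pzRingType) (C : lmodType S -> Prop).
Implicit Types (A K X : lmodType S).

(** Counting terms instead of degrees makes the zero module the base case. *)
Inductive res_len : nat -> lmodType S -> Prop :=
| res_len0 n A : is_zero A -> res_len n A
| res_lenS n A K X (i : {linear K -> X}) (g : {linear X -> A}) :
    short_exact i g -> C X -> res_len n K -> res_len n.+1 A.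

Inductive cores_len : nat -> lmodType S -> Prop :=
| cores_len0 n A : is_zero A -> cores_len n A
| cores_lenS n A K X (i : {linear A -> X}) (g : {linear X -> K}) :
    short_exact i g -> C X -> cores_len n K -> cores_len n.+1 A.

Lemma res_len_leq m n A : (m <= n)%N -> res_len m A -> res_len n A.
Proof.
move=> mn rA; elim: rA n mn => {m A} [m A A0 n _|m A K X i g ses CX _ IH [//|n] mn].
  exact: res_len0.
exact: res_lenS ses CX (IH _ mn).
Qed.

Lemma cores_len_leq m n A : (m <= n)%N -> cores_len m A -> cores_len n A.
Proof.
move=> mn rA; elim: rA n mn => {m A} [m A A0 n _|m A K X i g ses CX _ IH [//|n] mn].
  exact: cores_len0.
exact: cores_lenS ses CX (IH _ mn).
Qed.

Lemma res_len_of_le m A : res_le C m A -> res_len m.+1 A.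
Proof.
move=> [k [P [km CP P0]]]; apply: (@res_len_leq k.+1) => // {km}.
elim: k A P CP P0 => [|k IHk] A P CP P0;
  have [a [aE a_ex a_surj]] := syzygy_aug P;
  apply: (res_lenS (ker_ses (res_surj P)) (CP 0%N isT)).
  by apply: res_len0 => x; have [y <-] := a_surj x; rewrite (P0 1%N _ y) // linear0.
apply: (IHk _ (syzygy_resolution a_ex a_surj)) => i ik; [exact: CP | exact: P0].
Qed.

Lemma zero_exact A (f g : A -> A) : is_zero A -> @exact S A A A f g.
Proof.
by move=> A0 x; split=> _; [exists 0; rewrite (A0 (f 0)) (A0 x) | rewrite (A0 (g x))].
Qed.

Definition zero_resolution A (A0 : is_zero A) : resolution A :=
  @Resolution S A (fun _ => A) (fun _ => zero_lin A A) idfun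
    (fun _ => zero_exact _ _ A0) (zero_exact _ _ A0)
    (fun x => ex_intro _ x erefl).

Lemma res_le_of_len m A : module_class C -> res_len m.+1 A -> res_le C m A.
Proof.
move=> [_ C0].
suff h n : res_len n A -> if n is m.+1 then res_le C m A else is_zero A by apply: h.
elim=> {n A} [[|n] A A0|n A K X i g [inj ex surj] CX _] //.
  by exists 0%N, (zero_resolution A0); split=> // i _; apply: C0.
case: n => [K0|n [k [P [kn CP P0]]]].
  exists 0%N, (splice (zero_resolution K0) inj ex surj).
  by split=> // -[|j].
exists k.+1, (splice P inj ex surj); split=> // -[|j] //=; [exact: CP|exact: P0].
Qed.

Section Cosplice.
Context K (Q : coresolution K) X A (i : {linear A -> X}) (g : {linear X -> K}).

Definition cosplice_d (j : nat) :
    {linear splice_obj X Q j -> splice_obj X Q j.+1} :=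
  match j with
  | 0 => (cores_aug Q \o g)%FUN
  | k.+1 => cores_d Q k
  end.

Lemma cosplice_exact j : surjective g -> exact (cosplice_d j) (cosplice_d j.+1).
Proof.
move=> surj; case: j => [|j]; last exact: cores_exact.
move=> x; rewrite -[_ <-> _]/(cores_d Q 0 x = 0 <-> _) (cores_exact0 x).
split=> [[k <-]|[y <-]]; last by exists (g y).
by have [y <-] := surj k; exists y.
Qed.

Lemma cosplice_exact0 : exact i g -> exact i (cosplice_d 0).
Proof.
move=> ex x; rewrite -(ex x); split=> /= [gx|->]; last exact: linear0.
by apply: (@cores_inj _ _ Q); rewrite gx linear0.
Qed.

Definition cosplice (inj : injective i) (ex : exact i g) (surj : surjective g) :
    coresolution A :=
  @Coresolution S A (splice_obj X Q) cosplice_d i inj (cosplice_exact0 ex)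
    (fun j => @cosplice_exact j surj).

End Cosplice.

Definition zero_coresolution A (A0 : is_zero A) : coresolution A :=
  @Coresolution S A (fun _ => A) (fun _ => zero_lin A A) idfun
    (fun x y xy => xy) (zero_exact _ _ A0) (fun _ => zero_exact _ _ A0).

(** The cokernel of A -> Q^0, realised inside Q^1. *)
Lemma cosyzygy A (Q : coresolution A) :
  exists g : {linear Q 0%N -> ker (cores_d Q 1)},
    short_exact (cores_aug Q) g /\
    exists Q' : coresolution (ker (cores_d Q 1)), forall i, Q' i = Q i.+1.
Proof.
have [||x|g gE] := @ker_lift _ _ _ _ _ (ker_incl (cores_d Q 1)) (cores_d Q 1)
  (cores_d Q 0).
- exact: ker_incl_inj.
- exact: ker_incl_exact.
- exact/exact_comp0/cores_exact.
exists g; split; last first.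
  by exists (@Coresolution S _ (fun i => Q i.+1) (fun i => cores_d Q i.+1)
    (ker_incl (cores_d Q 1)) (@ker_incl_inj _ _ _ _) (@ker_incl_exact _ _ _ _)
    (fun i => @cores_exact _ _ Q i.+1)).
split=> [|x|k]; first exact: cores_inj.
  rewrite -(cores_exact0 x) -gE; split=> [->|g0]; first by rewrite linear0.
  by apply: ker_incl_inj; rewrite g0 linear0.
have /cores_exact[x xE] : cores_d Q 1 (ker_incl _ k) = 0.
  by apply/(ker_incl_exact (cores_d Q 1)); exists k.
by exists x; apply: ker_incl_inj; rewrite gE.
Qed.

Lemma cores_len_of_le m A : cores_le C m A -> cores_len m.+1 A.
Proof.
move=> [k [Q [km CQ Q0]]]; apply: (@cores_len_leq k.+1) => // {km}.
elim: k A Q CQ Q0 => [|k IHk] A Q CQ Q0;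
  have [g [ses [Q' Q'E]]] := cosyzygy Q; apply: (cores_lenS ses (CQ 0%N isT)).
  by apply: cores_len0 => x; apply: ker_incl_inj; rewrite linear0; apply: (Q0 1%N).
by apply: (IHk _ Q') => i ik; rewrite Q'E; [apply: CQ | apply: Q0].
Qed.

Lemma cores_le_of_len m A : module_class C -> cores_len m.+1 A -> cores_le C m A.
Proof.
move=> [_ C0].
suff h n : cores_len n A -> if n is m.+1 then cores_le C m A else is_zero A by apply: h.
elim=> {n A} [[|n] A A0|n A K X i g [inj ex surj] CX _] //.
  by exists 0%N, (zero_coresolution A0); split=> // i _; apply: C0.
case: n => [K0|n [k [Q [kn CQ Q0]]]].
  exists 0%N, (cosplice (zero_coresolution K0) inj ex surj).
  by split=> // -[|j].
exists k.+1, (cosplice Q inj ex surj); split=> // -[|j] //=; [exact: CQ|exact: Q0].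
Qed.

End FiniteResolutions.

(** * Left cotorsion pairs: the class J *)

Section ClassJ.
Context (R : pzRingType) (M : bimodType R).
Implicit Types (E N P X Y : lmodType R) (Z : lmodType (trivext M)).

Definition beta_lin Z : {linear base Z -> modHom M (base Z)} := beta Z.

Lemma hmapE X Y (g : {linear X -> Y}) (f : modHom M X) m :
  hom_fun (hmap M g f) m = g (hom_fun f m).
Proof. by []. Qed.

Lemma hom_fun0 Y m : hom_fun (0 : modHom M Y) m = 0.
Proof. by []. Qed.

Lemma hmap_inj X Y (i : {linear X -> Y}) : injective i -> injective (hmap M i).
Proof.
by move=> inj f g fg; apply: hom_ext => m; apply: inj; rewrite -!hmapE fg.
Qed.

Lemma hmap_exact N X Y (i : {linear N -> X}) (g : {linear X -> Y}) :
  injective i -> exact i g -> exact (hmap M i) (hmap M g).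
Proof.
move=> inj ex f; split=> [gf|[h <-]]; last first.
  by apply: hom_ext => m; rewrite !hmapE (exact_comp0 ex).
have [m|h hE] := ker_lift (h := hom_fun f) inj ex; first by rewrite -hmapE gf.
by exists h; apply: hom_ext => m; rewrite hmapE -hE.
Qed.

Lemma hmap_ses N X Y (i : {linear N -> X}) (g : {linear X -> Y}) :
  ext_van N 0 M -> short_exact i g -> short_exact (hmap M i) (hmap M g).
Proof.
move=> vM ses; have [inj ex _] := ses; split.
- exact: hmap_inj.
- exact: hmap_exact.
- move=> f; have [h hE] := ext_lift (hom_fun f) vM ses.
  by exists h; apply: hom_ext.
Qed.

Lemma ext_van_zero n Y X : is_zero Y -> ext_van Y n X.
Proof.
move=> Y0; elim: n X => [|n IHn] X.
  by move=> N E i g _ f; exists (zero_lin E Y) => k; rewrite (Y0 (f k)).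
have [N [P [i [g [pP ses]]]]] := projective_cover X.
by exists N, P, i, g; split.
Qed.

Lemma beta0P Z (z : base Z) : beta_lin Z z = 0 <-> forall m, ideal_act m z = 0.
Proof.
split=> [bz m|h]; last exact: hom_ext.
by rewrite -[LHS]/(hom_fun (beta_lin Z z) m) bz.
Qed.

Lemma beta_beta Z (z : base Z) : hmap M (beta_lin Z) (beta_lin Z z) = 0.
Proof.
by apply: hom_ext => m; apply/beta0P => m'; apply: ideal_act_act.
Qed.

(** Left exactness of Hom(M, -). *)
Lemma hmap_beta0 Z (f : modHom M (base Z)) :
  hmap M (beta_lin Z) f = 0 <-> exists f' : modHom M (ker (beta_lin Z)),
    hmap M (ker_incl (beta_lin Z)) f' = f.
Proof.
exact: (hmap_exact (@ker_incl_inj _ _ _ (beta_lin Z)) (@ker_incl_exact _ _ _ (beta_lin Z))).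
Qed.

(** Exactness of Z -> Hom(M, Z) -> Hom(M, Hom(M, Z)) identifies the quotient of Z
    by Ker beta with Hom(M, Ker beta). *)
Lemma beta_ses Z : exact (beta_lin Z) (hmap M (beta_lin Z)) ->
  exists q : {linear base Z -> modHom M (ker (beta_lin Z))},
    short_exact (ker_incl (beta_lin Z)) q.
Proof.
move=> ex.
have [||z|q qE] := @ker_lift _ _ _ _ _ (hmap M (ker_incl (beta_lin Z)))
  (hmap M (beta_lin Z)) (beta_lin Z).
- exact/hmap_inj/ker_incl_inj.
- exact/hmap_exact/ker_incl_exact/ker_incl_inj.
- exact: beta_beta.
exists q; split; first exact: ker_incl_inj.
  move=> z; rewrite -(ker_incl_exact (beta_lin Z) z) -qE.
  split=> [->|h]; first exact: linear0.
  by apply: (hmap_inj (@ker_incl_inj _ _ _ (beta_lin Z))); rewrite [LHS]h [RHS]linear0.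
move=> f; have /ex[z zE] : hmap M (beta_lin Z) (hmap M (ker_incl (beta_lin Z)) f) = 0.
  by apply/hmap_beta0; exists f.
by exists z; apply: (hmap_inj (@ker_incl_inj _ _ _ (beta_lin Z))); rewrite -zE; apply: qE.
Qed.

Section KerBetaMap.
Context (Z W : lmodType (trivext M)) (f : {linear Z -> W}).

Lemma beta_nat (z : base Z) : hmap M (bmap f) (beta_lin Z z) = beta_lin W (bmap f z).
Proof. by apply: hom_ext => m; apply: (bmap_act f). Qed.

Lemma ker_beta_map_ex : exists g : {linear ker (beta_lin Z) -> ker (beta_lin W)},
  forall z, ker_incl (beta_lin W) (g z) = bmap f (ker_incl (beta_lin Z) z).
Proof.
have [||z|g gE] := @ker_lift _ _ _ _ _ (ker_incl (beta_lin W)) (beta_lin W)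
  (bmap f \o ker_incl (beta_lin Z))%FUN.
- exact: ker_incl_inj.
- exact: ker_incl_exact.
- have bz : beta_lin Z (ker_incl (beta_lin Z) z) = 0.
    by apply/(ker_incl_exact (beta_lin Z)); exists z.
  by rewrite -[LHS]beta_nat bz linear0.
by exists g.
Qed.

End KerBetaMap.

(** Ker beta is left exact, and the obstruction to lifting an element of Ker beta_Z
    is a map M -> Ker beta_K modulo the image of beta_K, which is everything. *)
Lemma ker_beta_ses (K X Z : lmodType (trivext M)) (i : {linear K -> X})
    (g : {linear X -> Z}) :
  short_exact i g -> exact (beta_lin K) (hmap M (beta_lin K)) ->
  exact (beta_lin X) (hmap M (beta_lin X)) ->
  exists (i' : {linear ker (beta_lin K) -> ker (beta_lin X)})
         (g' : {linear ker (beta_lin X) -> ker (beta_lin Z)}),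
    short_exact i' g' /\
    forall x, ker_incl (beta_lin Z) (g' x) = bmap g (ker_incl (beta_lin X) x).
Proof.
move=> [inj ex surj] exK exX.
have [i' i'E] := ker_beta_map_ex i; have [g' g'E] := ker_beta_map_ex g.
exists i', g'; split=> //; split.
- move=> k k' kk; apply: ker_incl_inj; apply: inj.
  by rewrite -[LHS]i'E -[RHS]i'E kk.
- move=> x; split=> [gx|[k <-]]; last first.
    by apply: ker_incl_inj; rewrite g'E i'E linear0; apply: (exact_comp0 ex).
  have /ex[k kE] : bmap g (ker_incl (beta_lin X) x) = 0 by rewrite -g'E gx linear0.
  have /(ker_incl_exact (beta_lin K))[k' k'E] : beta_lin K k = 0.
    apply/beta0P => m; apply: inj; rewrite [LHS](bmap_act i) linear0.
    rewrite -[bmap i k]/(i k) kE; move: m; apply/beta0P.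
    by apply/(ker_incl_exact (beta_lin X)); exists x.
  by exists k'; apply: ker_incl_inj; rewrite i'E k'E.
- move=> z; have [x xE] := surj (ker_incl (beta_lin Z) z).
  have bz : beta_lin Z (ker_incl (beta_lin Z) z) = 0.
    by apply/(ker_incl_exact (beta_lin Z)); exists z.
  (* g x = z is killed by M, so m |-> m x takes values in the image of K *)
  have [m|h hE] := ker_lift (h := hom_fun (beta_lin X x)) (inj : injective (bmap i))
      (ex : exact (bmap i) (bmap g)).
    rewrite [LHS](bmap_act g) -[LHS]/(hom_fun (beta_lin Z (g x)) m) xE.
    by rewrite -[RHS](hom_fun0 (base Z) m) -bz.
  have /exK[k kE] : hmap M (beta_lin K) (h : modHom M (base K)) = 0.
    apply: hom_ext => m; apply/beta0P => m'; apply: inj.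
    rewrite [LHS](bmap_act i) hE linear0; exact: ideal_act_act.
  have /(ker_incl_exact (beta_lin X))[x' x'E] : beta_lin X ((x : base X) - bmap i k) = 0.
    rewrite linearB -beta_nat kE.
    have -> : hmap M (bmap i) h = beta_lin X x by apply: hom_ext => m; rewrite hmapE hE.
    exact: subrr.
  exists x'; apply: ker_incl_inj; rewrite g'E x'E linearB.
  have -> : bmap g (bmap i k) = 0 by apply: (exact_comp0 ex).
  by rewrite subr0.
Qed.

End ClassJ.

Lemma ker_unique (S : pzRingType) (K L X Y : lmodType S)
    (f : {linear X -> Y}) (i : {linear K -> X}) (j : {linear L -> X}) :
  injective i -> exact i f -> injective j -> exact j f -> iso K L.
Proof.
move=> i_inj i_ex j_inj j_ex.
have [u uE] := ker_lift (h := i) j_inj j_ex (exact_comp0 i_ex).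
apply: (iso_of_bij (f := u)) => [x y xy|l].
  by apply: i_inj; rewrite -!uE xy.
have /i_ex[k kE] : f (j l) = 0 by apply: exact_comp0 j_ex l.
by exists k; apply: j_inj; rewrite uE.
Qed.

Lemma is_zero_ker (S : pzRingType) (X Y : lmodType S) (f : {linear X -> Y}) :
  is_zero X -> is_zero (ker f).
Proof. by move=> X0 x; apply: ker_incl_inj; rewrite linear0; apply: X0. Qed.

Section FiniteJ.
Context (R : pzRingType) (M : bimodType R) (D : lmodType R -> Prop) (n : nat).
Hypothesis D_class : module_class D.
Hypothesis ext_MD : forall Y, D Y -> forall j, (j < n)%N -> ext_van Y j M.
Hypothesis hom_MD : forall Y, D Y -> D (modHom M Y).
Implicit Types Z : lmodType (trivext M).

Lemma classJ_ker Z : classJ M D Z -> D (ker (beta_lin Z)).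
Proof.
move=> [[K [i [i_inj i_ex DK]]] _]; have [D_iso _] := D_class.
apply: D_iso DK; apply: (ker_unique (f := beta_lin Z) (j := ker_incl _) i_inj i_ex).
  exact: ker_incl_inj.
exact: ker_incl_exact.
Qed.

(** The vanishing of Ext in the last conjunct is what lets maps M -> Ker beta_Z
    lift along the next step of the resolution; each step uses up one degree. *)
Lemma classJ_resolution k Z : res_len (classJ M D) k Z -> (k <= n)%N ->
  [/\ exact (beta_lin Z) (hmap M (beta_lin Z)), res_len D k (ker (beta_lin Z)),
      res_len D k (modHom M (ker (beta_lin Z)))
    & forall j, (j + k <= n)%N -> ext_van (ker (beta_lin Z)) j M].
Proof.
elim=> {k Z} [k Z Z0 _|k Z K X i g ses JX _ IHk kn].
  have N0 : is_zero (ker (beta_lin Z)) by apply: is_zero_ker.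
  split; [|exact: res_len0|apply: res_len0|by move=> j _; apply: ext_van_zero].
    move=> f; split=> _; last first.
      by apply: hom_ext => m; apply: hom_ext => m'; apply: Z0.
    by exists 0; apply: hom_ext => m; rewrite (Z0 (hom_fun f m)); apply: Z0.
  by move=> f; apply: hom_ext => m; apply: N0.
have [exK resK resHK extK] := IHk (ltnW kn).
have exX : exact (beta_lin X) (hmap M (beta_lin X)) by case: JX.
have DX := classJ_ker JX.
have [i' [g' [ses' g'E]]] := ker_beta_ses ses exK exX.
have vK : ext_van (ker (beta_lin K)) 0 M by apply: extK; apply: ltnW.
have hses := hmap_ses vK ses'.
split.
- move=> f; split=> [/hmap_beta0[h hE]|[z <-]]; last exact: beta_beta.
  have [_ _ /(_ h)[u uE]] := hses.
  have /exX[x xE] : hmap M (beta_lin X) (hmap M (ker_incl (beta_lin X)) u) = 0.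
    by apply/hmap_beta0; exists u.
  exists (bmap g x); rewrite -hE -uE -beta_nat [X in hmap M (bmap g) X]xE.
  by apply: hom_ext => m; rewrite !hmapE g'E.
- exact: res_lenS ses' DX resK.
- exact: res_lenS hses (hom_MD DX) resHK.
- move=> j jk; apply: (ext_shift_coef ses').
    by apply: (ext_MD DX); apply: leq_trans jk; rewrite addnS ltnS leq_addr.
  by apply: extK; rewrite addSnnS.
Qed.

Lemma classJ_res_base Z : closed_extensions (res_le D n.-1) ->
  res_le (classJ M D) n.-1 Z -> (0 < n)%N -> res_le D n.-1 (base Z).
Proof.
move=> D_ext /res_len_of_le resZ n_gt0; rewrite prednK // in resZ.
have [ex rN rH _] := classJ_resolution resZ (leqnn n).
have [q ses] := beta_ses ex.
by apply: D_ext ses _ _; apply: res_le_of_len => //; rewrite prednK.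
Qed.

End FiniteJ.

Section CoindJ.
Context (R : pzRingType) (M : bimodType R) (Y : lmodType R).
Local Notation W := (coind M Y).
Local Notation P := (Y * modHom M Y)%type.

Lemma coind_actE m (z : base W) : ideal_act m z = (hom_fun (z : P).2 m, 0) :> P.
Proof. exact: (ideal_actE (coind_action M Y) m z). Qed.

Lemma coind_beta0 (z : base W) : beta_lin W z = 0 <-> (z : P).2 = 0.
Proof.
split=> [/beta0P h|z0].
  by apply: hom_ext => m; have /(congr1 (fun p : P => p.1)) := h m; rewrite coind_actE.
by apply/beta0P => m; rewrite coind_actE z0.
Qed.

(** Ker beta is the summand Y, and a map from M into the annihilator of M has its
    values in Y, hence is the image under beta of an element of Hom(M, Y). *)
Lemma classJ_coind (D : lmodType R -> Prop) : D Y -> classJ M D W.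
Proof.
move=> DY; split.
  exists Y, (to_base (coind_action M Y) \o inl_lin Y (modHom M Y))%FUN; split=> //.
  - by move=> y y' [].
  - move=> z; split=> [/coind_beta0 z0|[y <-]]; last exact/coind_beta0.
    by exists (z : P).1; rewrite [RHS](surjective_pairing (z : P)) z0.
move=> f; split=> [/hmap_beta0[h hE]|[z <-]]; last exact: beta_beta.
have f0 m : (hom_fun f m : P).2 = 0.
  apply/coind_beta0/(ker_incl_exact (beta_lin W)); exists (hom_fun h m).
  by rewrite -hE.
pose f1 := hmap M (fst_lin Y (modHom M Y) \o of_base (coind_action M Y))%FUN f.
exists (to_base (coind_action M Y) (0, f1)); apply: hom_ext => m.
rewrite -[LHS]/(ideal_act m (to_base (coind_action M Y) (0, f1))) coind_actE.
by rewrite [RHS](surjective_pairing (hom_fun f m : P)) f0.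
Qed.

End CoindJ.

Section TrivMap.
Context (R : pzRingType) (M : bimodType R) (X Y : lmodType R) (f : {linear X -> Y}).

Lemma triv_actE (N : lmodType R) m (x : base (triv M N)) : ideal_act m x = 0.
Proof. exact: (ideal_actE (zero_action M N) m x). Qed.

Definition triv_base_map : {linear base (triv M X) -> base (triv M Y)} :=
  (to_base (zero_action M Y) \o f \o of_base (zero_action M X))%FUN.

Lemma triv_map_linear : linear (triv_base_map : triv M X -> triv M Y).
Proof. by apply: act_linear => m x; rewrite !triv_actE linear0. Qed.

Definition triv_map : {linear triv M X -> triv M Y} := mk_lin triv_map_linear.

End TrivMap.
Arguments triv_map {R} M {X Y} f.

(** X |-> (X, 0) preserves direct sums. *)
Lemma closed_summands_base (R : pzRingType) (M : bimodType R) (C : lmodType R -> Prop) :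
  module_class C -> closed_summands (classU M C) -> closed_summands C.
Proof.
move=> [C_iso _] summ A X Y [f fbij] CA.
apply: (C_iso _ _ (iso_sym (base_iso (zero_action M X)))).
apply: (summ (triv M A) (triv M X) (triv M Y)); last first.
  exact: (C_iso _ _ (base_iso (zero_action M A)) CA).
apply: (iso_of_bij (f := pair_lin (triv_map M (fst_lin X Y \o f)%FUN)
                                  (triv_map M (snd_lin X Y \o f)%FUN))).
  move=> a b [ab1 ab2]; apply: (bij_inj fbij).
  by rewrite [LHS]surjective_pairing [RHS]surjective_pairing; congr pair.
have [g fK gK] := fbij; move=> [x y]; exists (g (x, y)).
by congr pair; rewrite /= gK.
Qed.

Theorem left_cotorsion_base (R : pzRingType) (M : bimodType R) (n : nat)
    (C D : lmodType R -> Prop) :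
  (0 < n)%N -> module_class C -> module_class D ->
  left_cotorsion_pair n (classU M C) (classJ M D) ->
  (forall Y : lmodType R, D Y ->
     (forall i : nat, (1 <= i <= n)%N -> Ext_zero i M Y) /\ D (modHom M Y)) ->
  closed_extensions (res_le D n.-1) ->
  left_cotorsion_pair n C D.
Proof.
move=> n_gt0 C_class D_class [summ orth appr] hD D_ext.
have [C_iso _] := C_class.
have ext_MD Y : D Y -> forall j, (j < n)%N -> ext_van Y j M.
  by move=> DY j jn; have [h _] := hD Y DY; apply/ext_vanP/h.
have hom_MD Y : D Y -> D (modHom M Y) by move=> /hD[].
split; first exact: closed_summands_base summ.
- move=> [//|i] X Y /andP[_ ilt] CX DY; apply/ext_vanP.
  have vX : ext_van Y i (base (triv M X)).
    apply: (@ext_coinduced _ M) => [j ji|].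
      exact: ext_MD DY _ (leq_ltn_trans ji ilt).
    apply/ext_vanP; apply: orth => //; last exact: classJ_coind.
    exact: (C_iso _ _ (base_iso (zero_action M X))).
  exact: (ext_retract (s := to_base (zero_action M X))
            (p := of_base (zero_action M X))) vX.
- move=> A; have [K [X [f [g [[inj ex surj] CX resK]]]]] := appr (triv M A).
  exists (base K), (base X), (bmap f), (of_base (zero_action M A) \o bmap g)%FUN.
  split=> //.
  exact: (classJ_res_base D_class ext_MD hom_MD).
Qed.

(** * Right cotorsion pairs: the class B *)

Lemma coker_unique (S : pzRingType) (K L X Y : lmodType S)
    (f : {linear X -> Y}) (p : {linear Y -> K}) (q : {linear Y -> L}) :
  exact f p -> surjective p -> exact f q -> surjective q -> iso K L.
Proof.
move=> p_ex p_surj q_ex q_surj.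
have [y /p_ex[x <-]|u uE] := coker_lift (h := q) p_surj; first exact: exact_comp0 q_ex x.
apply: (iso_of_bij (f := u)) => [|l].
  apply: linear_inj0 => k; have [y <-] := p_surj k.
  by rewrite uE => /q_ex[x <-]; apply: exact_comp0 p_ex x.
by have [y <-] := q_surj l; exists (p y).
Qed.

Section ClassB.
Context (R : pzRingType) (M : bimodType R).
Implicit Types (N X Y : lmodType R) (Z : lmodType (trivext M)).

Definition alpha_lin Z : {linear tensor M (base Z) -> base Z} := alpha Z.

Lemma tmap_lin0 X Y (f : {linear X -> Y}) : tmap M f 0 = 0.
Proof. exact: (linear0 (tmap M f : {linear tensor M X -> tensor M Y})). Qed.

Lemma alpha_alpha Z t : alpha_lin Z (tmap M (alpha_lin Z) t) = 0.
Proof.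
apply: (tensor_hom_eq (f := (alpha_lin Z \o tmap M (alpha_lin Z))%FUN)
  (g := zero_lin _ _)) => m.
elim/tensor_ind=> [|t1 t2 h1 h2|m' x].
- by rewrite /= tmap_tens linear0 [LHS]alpha_tens ideal_act0.
- rewrite tensDr [LHS]linearD h1 h2; exact: addr0.
- by rewrite /= tmap_tens [LHS]alpha_tens [X in ideal_act m X]alpha_tens ideal_act_act.
Qed.

Local Notation T Z := (coker (alpha_lin Z)).
Local Notation pi Z := (coker_proj (alpha_lin Z)).

Lemma coker_alpha_exact Z : exact (alpha_lin Z) (pi Z).
Proof. exact: coker_proj_exact. Qed.

Lemma coker_alpha_surj Z : surjective (pi Z).
Proof. exact: coker_proj_surj. Qed.

Lemma tens_coker_act Z : exists c : {linear tensor M (T Z) -> base Z},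
  forall t, c (tmap M (pi Z) t) = alpha_lin Z t.
Proof.
have [t|c cE] := coker_lift (g := tmap M (pi Z)) (h := alpha_lin Z)
  (tmap_surj (@coker_alpha_surj Z)).
  move=> /(tmap_exact (@coker_alpha_exact Z) (@coker_alpha_surj Z))[u <-].
  exact: alpha_alpha.
by exists c.
Qed.

(** Exactness of M (x) M (x) Z -> M (x) Z -> Z says that the action induces an
    isomorphism from M (x) Coker alpha onto its image. *)
Lemma tens_coker_act_inj Z (c : {linear tensor M (T Z) -> base Z}) :
  (forall t, c (tmap M (pi Z) t) = alpha_lin Z t) ->
  exact (tmap M (alpha_lin Z)) (alpha_lin Z) <-> injective c.
Proof.
move=> cE; split=> [ex|inj t].
  apply: linear_inj0 => s; have [t <-] := tmap_surj (@coker_alpha_surj Z) s.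
  rewrite cE => /ex ?.
  exact/(tmap_exact (@coker_alpha_exact Z) (@coker_alpha_surj Z)).
split=> [t0|[u <-]]; last exact: alpha_alpha.
apply/(tmap_exact (@coker_alpha_exact Z) (@coker_alpha_surj Z)).
by apply: inj; rewrite cE t0 linear0.
Qed.

Lemma alpha_ses Z : exact (tmap M (alpha_lin Z)) (alpha_lin Z) ->
  exists c : {linear tensor M (T Z) -> base Z}, short_exact c (pi Z).
Proof.
move=> ex; have [c cE] := tens_coker_act Z; exists c; split.
- exact/(tens_coker_act_inj cE).
- move=> z; rewrite (coker_alpha_exact z); split=> [[t <-]|[s <-]].
    by exists (tmap M (pi Z) t).
  by have [t <-] := tmap_surj (@coker_alpha_surj Z) s; exists t; rewrite cE.
- exact: coker_alpha_surj.
Qed.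

Lemma coker_alpha_map (Z W : lmodType (trivext M)) (f : {linear Z -> W}) :
  exists f' : {linear T Z -> T W}, forall z, f' (pi Z z) = pi W (bmap f z).
Proof.
have [z /coker_alpha_exact[t <-]|f' f'E] := coker_lift
  (h := (pi W \o bmap f)%FUN) (@coker_alpha_surj Z); last by exists f'.
rewrite -[LHS]/(pi W (bmap f (alpha Z t))) alpha_nat; apply/coker_alpha_exact.
by exists (tmap M (bmap f) t).
Qed.

(** Dually to Ker beta, Coker alpha is exact here because M (x) Coker alpha_W -> W
    is injective. *)
Lemma coker_alpha_ses (Z B W : lmodType (trivext M)) (i : {linear Z -> B})
    (g : {linear B -> W}) :
  short_exact i g -> exact (tmap M (alpha_lin W)) (alpha_lin W) ->
  exists (i' : {linear T Z -> T B}) (g' : {linear T B -> T W}),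
    short_exact i' g' /\ forall z, i' (pi Z z) = pi B (bmap i z).
Proof.
move=> [inj ex surj] exW.
have [i' i'E] := coker_alpha_map i; have [g' g'E] := coker_alpha_map g.
have g'_surj : surjective g'.
  move=> w'; have [w <-] := coker_alpha_surj w'; have [b bE] := surj w.
  by exists (pi B b); rewrite g'E -[bmap g b]/(g b) bE.
have ex' : exact i' g'.
  move=> b'; have [b <-] := coker_alpha_surj b'; split=> [|[z' <-]]; last first.
    have [z <-] := coker_alpha_surj z'; rewrite i'E g'E.
    have -> : bmap g (bmap i z) = 0 by apply: (exact_comp0 ex).
    exact: linear0.
  rewrite g'E => /coker_alpha_exact[u uE].
  have [t tE] := tmap_surj (M := M) (surj : surjective (bmap g)) u.
  have /ex[z zE] : g ((b : base B) - alpha_lin B t) = 0.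
    rewrite -[LHS]/(bmap g ((b : base B) - alpha_lin B t)) linearB.
    by rewrite alpha_nat tE uE subrr.
  exists (pi Z z); rewrite i'E -[bmap i z]/(i z) zE linearB.
  by rewrite (exact_comp0 (@coker_alpha_exact B)) subr0.
exists i', g'; split=> //; split=> //.
apply: linear_inj0 => z'; have [z <-] := coker_alpha_surj z'.
rewrite i'E => /coker_alpha_exact[t tE].
have [[cZ cZE] [cB cBE]] := (tens_coker_act Z, tens_coker_act B).
have [cW cWE] := tens_coker_act W.
have cW_inj : injective cW by apply/(tens_coker_act_inj cWE).
have nat_g s : cW (tmap M g' s) = bmap g (cB s).
  have [r <-] := tmap_surj (@coker_alpha_surj B) s.
  rewrite cBE alpha_nat -[RHS]cWE; congr (cW _).
  rewrite -(tmap_comp (h := (g' \o pi B)%FUN)) //; apply: tmap_comp => x /=.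
  exact: g'E.
have nat_i s : cB (tmap M i' s) = bmap i (cZ s).
  have [r <-] := tmap_surj (@coker_alpha_surj Z) s.
  rewrite cZE alpha_nat -[RHS]cBE; congr (cB _).
  rewrite -(tmap_comp (h := (i' \o pi Z)%FUN)) //; apply: tmap_comp => x /=.
  exact: i'E.
have /(tmap_exact ex' g'_surj)[s sE] : tmap M g' (tmap M (pi B) t) = 0.
  by apply: cW_inj; rewrite nat_g cBE tE linear0; apply: (exact_comp0 ex).
apply/coker_alpha_exact.
have [r rE] := tmap_surj (@coker_alpha_surj Z) s.
exists r; apply: inj.
by rewrite -[LHS]/(bmap i (alpha_lin Z r)) -cZE rE -nat_i sE cBE tE.
Qed.

End ClassB.

Lemma is_zero_surj (S : pzRingType) (X Y : lmodType S) (f : {linear X -> Y}) :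
  surjective f -> is_zero X -> is_zero Y.
Proof. by move=> surj X0 y; have [x <-] := surj y; rewrite (X0 x) linear0. Qed.

Section FiniteB.
Context (R : pzRingType) (M : bimodType R) (C : lmodType R -> Prop) (n : nat).
Hypothesis C_class : module_class C.
Hypothesis tor_MC : forall X, C X -> forall j, (j < n)%N -> tor_van M j X.
Hypothesis tens_MC : forall X, C X -> C (tensor M X).
Implicit Types Z : lmodType (trivext M).
Local Notation T Z := (coker (alpha_lin Z)).

Lemma classB_coker Z : classB M C Z -> C (T Z).
Proof.
move=> [[L [p [p_ex p_surj CL]]] _]; have [C_iso _] := C_class.
apply: C_iso CL; apply: (coker_unique (f := alpha_lin Z) p_ex p_surj).
  exact: coker_alpha_exact.
exact: coker_alpha_surj.
Qed.

Lemma is_zero_tensor (X : lmodType R) : is_zero X -> is_zero (tensor M X).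
Proof.
move=> X0 t; rewrite -[LHS](tmap_id (h := idfun)) //; apply: tmap_zero => x.
exact: X0.
Qed.

(** Dual to [classJ_resolution]: the vanishing of Tor in the last conjunct keeps
    M (x) Coker alpha_Z injecting into the next term of the coresolution. *)
Lemma classB_coresolution k Z : cores_len (classB M C) k Z -> (k <= n)%N ->
  [/\ exact (tmap M (alpha_lin Z)) (alpha_lin Z), cores_len C k (T Z),
      cores_len C k (tensor M (T Z)) & forall j, (j + k <= n)%N -> tor_van M j (T Z)].
Proof.
elim=> {k Z} [k Z Z0 _|k Z W B i g ses BB _ IHk kn].
  have T0 : is_zero (T Z) by apply: is_zero_surj (@coker_alpha_surj _ _ Z) _.
  split; [|exact: cores_len0|exact/cores_len0/is_zero_tensor|].
    move=> t; split=> _; last exact: Z0.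
    by exists 0; rewrite (is_zero_tensor (Z0 : is_zero (base Z)) t) tmap_lin0.
  by move=> j _; apply/tor_projective/projective_zero.
have [exW coresW coresMW torW] := IHk (ltnW kn).
have CB := classB_coker BB.
have [i' [g' [ses' i'E]]] := coker_alpha_ses ses exW.
have [inj' ex' surj'] := ses'.
have tinj : injective (tmap M i').
  have vW : tor_van M 0 (T W) := torW 0%N (ltnW kn).
  exact: (vW _ _ _ _ ses').
have tses : short_exact (tmap M i') (tmap M g').
  by split; [exact: tinj | exact: tmap_exact | exact: tmap_surj].
split.
- have [[cZ cZE] [cB cBE]] := (tens_coker_act Z, tens_coker_act B).
  have cB_inj : injective cB by apply/(tens_coker_act_inj cBE); case: BB.
  apply/(tens_coker_act_inj cZE); apply: linear_inj0 => s s0.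
  apply: tinj; apply: cB_inj; rewrite tmap_lin0 linear0.
  have [r rE] := tmap_surj (@coker_alpha_surj _ _ Z) s.
  have ar0 : alpha_lin Z r = 0 by rewrite -cZE rE.
  rewrite -rE -(tmap_comp (h := (i' \o coker_proj (alpha_lin Z))%FUN)) //.
  rewrite (tmap_comp (f := bmap i) (g := coker_proj (alpha_lin B))) => [|z].
    by rewrite cBE -[LHS]alpha_nat [X in bmap i X]ar0 linear0.
  by rewrite /= i'E.
- exact: cores_lenS ses' CB coresW.
- exact: cores_lenS tses (tens_MC CB) coresMW.
- move=> j jk; apply: tor_shift ses' (torW j.+1 _) (tor_MC CB _).
    by rewrite addSnnS.
  by apply: leq_trans jk; rewrite addnS ltnS leq_addr.
Qed.

Lemma classB_cores_base Z : closed_extensions (cores_le C n.-1) ->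
  cores_le (classB M C) n.-1 Z -> (0 < n)%N -> cores_le C n.-1 (base Z).
Proof.
move=> C_ext /cores_len_of_le coresZ n_gt0; rewrite prednK // in coresZ.
have [ex cT cM _] := classB_coresolution coresZ (leqnn n).
have [c ses] := alpha_ses ex.
by apply: C_ext ses _ _; apply: cores_le_of_len => //; rewrite prednK.
Qed.

End FiniteB.

Section IndB.
Context (R : pzRingType) (M : bimodType R) (X : lmodType R).
Local Notation W := (ind M X).
Local Notation P := (X * tensor M X)%type.

Definition ind_fst : {linear base W -> X} :=
  (fst_lin X (tensor M X) \o of_base (ind_action M X))%FUN.
Definition ind_inr : {linear tensor M X -> base W} :=
  (to_base (ind_action M X) \o inr_lin X (tensor M X))%FUN.

Lemma ind_alphaE t : alpha_lin W t = ind_inr (tmap M ind_fst t).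
Proof.
apply: (tensor_hom_eq (f := alpha_lin W) (g := (ind_inr \o tmap M ind_fst)%FUN)) => m [x t'].
by rewrite [LHS]alpha_tens ind_actE /= tmap_tens.
Qed.

Lemma ind_inrE t : ind_inr t = alpha_lin W (tmap M (to_ind M X) t).
Proof. by rewrite ind_alphaE -(tmap_comp (h := idfun)) // tmap_id. Qed.

(** alpha factors as M (x) W -> M (x) X -> W, where the first map is induced by the
    projection W -> X and the second is the inclusion of a summand. *)
Lemma classB_ind (C : lmodType R -> Prop) : C X -> classB M C W.
Proof.
have fst_surj : surjective ind_fst by move=> x; exists (to_ind M X x).
have fst_ex : exact ind_inr ind_fst.
  move=> z; split=> [z0|[t <-]] //; exists (z : P).2.
  by rewrite [RHS](surjective_pairing (z : P)) -[(z : P).1]/(ind_fst z) z0.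
move=> CX; split.
  exists X, ind_fst; split=> // z; rewrite (fst_ex z).
  split=> [[t <-]|[t <-]]; first by exists (tmap M (to_ind M X) t); rewrite [RHS]ind_inrE.
  by exists (tmap M ind_fst t); rewrite -ind_alphaE.
move=> t; split=> [t0|[u <-]]; last exact: alpha_alpha.
have /(tmap_exact fst_ex fst_surj)[v <-] : tmap M ind_fst t = 0.
  have : ind_inr (tmap M ind_fst t) = 0 by rewrite -ind_alphaE.
  by move=> /(congr1 (fun p : P => p.2)).
exists (tmap M (tmap M (to_ind M X)) v).
rewrite -(tmap_comp (h := ind_inr)) // => s; exact: ind_inrE.
Qed.

End IndB.

Theorem right_cotorsion_base (R : pzRingType) (M : bimodType R) (n : nat)
    (C D : lmodType R -> Prop) :
  (0 < n)%N -> module_class C -> module_class D ->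
  right_cotorsion_pair n (classB M C) (classU M D) ->
  (forall X : lmodType R, C X ->
     (forall i : nat, (1 <= i <= n)%N -> Tor_zero i M X) /\ C (tensor M X)) ->
  closed_extensions (cores_le C n.-1) ->
  right_cotorsion_pair n C D.
Proof.
move=> n_gt0 C_class D_class [summ orth appr] hC C_ext.
have [D_iso _] := D_class.
have tor_MC X : C X -> forall j, (j < n)%N -> tor_van M j X.
  by move=> CX j jn; have [h _] := hC X CX; apply/tor_vanP/h.
have tens_MC X : C X -> C (tensor M X) by move=> /hC[].
split; first exact: closed_summands_base summ.
- move=> [//|i] X Y /andP[_ ilt] CX DY; apply/ext_vanP.
  apply: (@ext_induced _ M) => [j ji|].
    exact: tor_MC CX _ (leq_ltn_trans ji ilt).
  apply/ext_vanP; apply: orth => //; first exact: classB_ind.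
  exact: (D_iso _ _ (base_iso (zero_action M Y))).
- move=> A; have [Y [K [f [g [[inj ex surj] DY coresK]]]]] := appr (triv M A).
  exists (base Y), (base K), (bmap f \o to_base (zero_action M A))%FUN, (bmap g).
  split=> //.
  exact: (classB_cores_base C_class tor_MC tens_MC).
Qed.

Theorem theorem4p6 (R : pzRingType) (M : bimodType R) (n : nat)
    (C D : lmodType R -> Prop) :
  (1 <= n)%N -> module_class C -> module_class D ->
  (left_cotorsion_pair n (classU M C) (classJ M D) ->
   (forall Y : lmodType R, D Y ->
      [/\ forall i : nat, (1 <= i <= n)%N -> Ext_zero i M Y,
          Ext_zero 1 (modHom M Y) Y & D (modHom M Y)]) ->
   closed_extensions (res_le D n.-1) ->
   left_cotorsion_pair n C D)
  /\
  (right_cotorsion_pair n (classB M C) (classU M D) ->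
   (forall X : lmodType R, C X ->
      [/\ forall i : nat, (1 <= i <= n)%N -> Tor_zero i M X,
          Ext_zero 1 X (tensor M X) & C (tensor M X)]) ->
   closed_extensions (cores_le C n.-1) ->
   right_cotorsion_pair n C D).
Proof.
move=> n_gt0 C_class D_class; split=> [lp hD D_ext|rp hC C_ext].
  by apply: left_cotorsion_base lp _ D_ext => // Y /hD[].
by apply: right_cotorsion_base rp _ C_ext => // X /hC[].
Qed.
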